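(* Let $n\ge1$, let $0\le\alpha<1$, and let $f\in Q_B^{\alpha}(D^n)$, i.e. $f:D^n\to\mathbb{C}^n$ is a normalized quasi-convex mapping of type B and order $\alpha$ on the unit polydisk $D^n$. Then $$\left\|\frac{D^3f(0)(x^3)}{3!}-\frac{2}{3}\,\frac{D^2f(0)}{2!}\left(x,\frac{D^2f(0)(x^2)}{2!}\right)\right\|\le\frac{1-\alpha}{3}\|x\|^3\qquad\text{for all }x\in D^n .$$ This inequality is sharp: for each $n$ and $\alpha$ the constant $\frac{1-\alpha}{3}$ cannot be replaced by a smaller one valid for all $f\in Q_B^\alpha(D^n)$ and all $x\in D^n$.
   Context: $\mathbb{C}^n$ carries the norm $\|z\|=\max_{1\le k\le n}|z_k|$, and $D^n=\{z\in\mathbb{C}^n:\|z\|<1\}$ is its open unit ball. For $x\ne0$, $T(x)=\{T_x\in(\mathbb{C}^n)^*:\|T_x\|=1,\ T_x(x)=\|x\|\}$. For holomorphic $f:D^n\to\mathbb{C}^n$, $D^mf(x)$ is the $m$-th Fréchet derivative at $x$ (a symmetric $m$-linear map), $D^mf(x)(y^m)=D^mf(x)(y,\dots,y)$, and $\frac{D^2f(0)}{2!}(x,y)=\frac12D^2f(0)(x,y)$. $f$ is normalized if $f(0)=0$, $Df(0)=I$, and locally biholomorphic if $Df(x)$ is invertible for each $x\in D^n$. $Q_B^\alpha(D^n)$ (quasi-convex mappings of type B and order $\alpha$) is the family of normalized locally biholomorphic mappings $f:D^n\to\mathbb{C}^n$ such that $\mathrm{Re}\{T_x[(Df(x))^{-1}(D^2f(x)(x^2)+Df(x)x)]\}\ge\alpha\|x\|$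 for all $x\in D^n\setminus\{0\}$ and all $T_x\in T(x)$. *)

(* Defs.v *)
From HB Require Import structures.
From mathcomp Require Import all_boot all_order all_algebra.
From mathcomp Require Import all_classical all_reals all_analysis.
From mathcomp Require Import complex.

Set Implicit Arguments.
Unset Strict Implicit.
Unset Printing Implicit Defensive.

Import Order.TTheory GRing.Theory Num.Theory.
Import numFieldNormedType.Exports.

Local Open Scope classical_set_scope.
Local Open Scope ring_scope.

(* The complex numbers, packed as a [numClosedFieldType] so that the topology
   and the norm given by MathComp-Analysis to every such field are inferred. *)
Definition C (R : realType) : numClosedFieldType := R[i]%C.

(* The norm of a normed space over [C R] takes its values in [C R], where it is
   a nonnegative real number; [rnorm] is this number as an element of [R].
   On ['rV[C R]_n] the library's norm is the maximum of the moduli of the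
   coordinates. *)
Definition rnorm (R : realType) (V : normedModType (C R)) (v : V) : R :=
  complex.Re (`|v| : R[i]%C).

Definition polydisk (R : realType) (n : nat) : set 'rV[C R]_n :=
  [set z | rnorm z < 1].

(* All linear functionals on C^n are continuous, so [{linear _ -> _}] is the
   whole dual space. *)
Definition dual_norm (R : realType) (n : nat)
    (T : {linear 'rV[C R]_n -> (C R)^o}) : R :=
  sup [set rnorm (T y) | y in [set y : 'rV[C R]_n | rnorm y <= 1]].

Definition support_functionals (R : realType) (n : nat) (x : 'rV[C R]_n) :
    set {linear 'rV[C R]_n -> (C R)^o} :=
  [set T | dual_norm T = 1 /\ T x = ((rnorm x)%:C)%C].

(* [frechet f x [:: v1; ...; vm]] is D^m f(x)(v1, ..., vm), where D^m f is the
   derivative of D^(m-1) f: since evaluation at (v2, ..., vm) is a continuous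
   linear map, D^m f(x)(v1, ..., vm) is the differential at x, in the
   direction v1, of y |-> D^(m-1) f(y)(v2, ..., vm). *)
Fixpoint frechet (K : numFieldType) (V W : normedModType K)
    (f : V -> W) (x : V) (vs : seq V) : W :=
  if vs is v :: vs' then 'd (fun y => frechet f y vs') x v else f x.

Section Mappings.
Variables (R : realType) (n : nat).
Implicit Types f : 'rV[C R]_n -> 'rV[C R]_n.

(* A mapping of the polydisk is represented by a total function, of which only
   the values on the (open) polydisk matter. *)
Definition holomorphic f : Prop :=
  forall x, polydisk x -> differentiable f x.

(* ['J f x] is the matrix of Df(x) acting on row vectors from the right. *)
Definition normalized f : Prop := f 0 = 0 /\ 'J f 0 = 1%:M.

Definition locally_biholomorphic f : Prop :=
  holomorphic f /\ forall x, polydisk x -> 'J f x \in unitmx.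

Definition quasi_convex_B (alpha : R) f : Prop :=
  [/\ normalized f, locally_biholomorphic f &
      forall x, polydisk x -> x != 0 -> forall T, support_functionals x T ->
        alpha * rnorm x <=
        complex.Re (T ((frechet f x [:: x; x] + frechet f x [:: x])
                         *m invmx ('J f x)) : R[i]%C)].

Definition third_order_functional f (x : 'rV[C R]_n) : 'rV[C R]_n :=
  let D2 u v := (2`!%:R)^-1 *: frechet f 0 [:: u; v] in
  (3`!%:R)^-1 *: frechet f 0 [:: x; x; x] - (2 / 3) *: D2 x (D2 x x).

End Mappings.

(* Main.v *)
From HB Require Import structures.
Require Import Defs.
From mathcomp Require Import all_boot all_order all_algebra.
From mathcomp Require Import all_classical all_reals all_analysis.
From mathcomp Require Import complex ring lra.
Import Order.TTheory GRing.Theory Num.Theory.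
Import numFieldNormedType.Exports.
Set Implicit Arguments.
Unset Strict Implicit.
Unset Printing Implicit Defensive.
Local Open Scope classical_set_scope.
Local Open Scope ring_scope.

(** Upper bound.  For x on the torus |x_k| = 1 and
    P(s) = Df(sx)^-1 (s D^2f(sx)(x^2) + Df(sx)x), the function
    p(s) = conj(x_k) P(s)_k is holomorphic on the unit disc, Re p >= alpha, and
    p = 1 + b1 s + b2 s^2 + ..., where b2 is conj(x_k) times the k-th coordinate
    of 6 (D^3f(0)(x^3)/3! - 2/3 D^2f(0)/2!(x, D^2f(0)(x^2)/2!)).  Caratheodory's
    bound |b2| <= 2 (1 - alpha) settles the torus, and the maximum principle, one
    coordinate at a time, the polydisc.

    Cauchy theory without integrals.  Riemann sums of a contour integral over a
    rectangle with 2^m points per side split exactly under bisection and vanish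
    on affine functions, so Goursat's nested rectangles show that they tend to 0.
    Through exp, the means over the 2^m-th roots of unity scaled by r have a limit
    independent of r; this yields the value, the derivative and the second
    coefficient at the centre, hence Cauchy estimates and the differentiability
    of the derivative.

    Sharpness.  The map f(z)_k = g(z_k) with g' = (1 - z^2)^(alpha - 1) is
    extremal; replacing g' by a Taylor polynomial of (1 - r z^2)^(alpha - 1) with
    r close to 1 keeps f polynomial. *)

(** * Real-valued norm and differentials *)

(** For fixed k the definition of type B controls only points where the k-th coordinate attains the
    norm. On the torus this holds for every k along the whole disc s |-> sx, so all coordinates of
    the quadratic coefficient are bounded there; at other points most coordinates escape, hence the
    detour through the maximum principle. The constant is 2 (1 - alpha) / 6, the 6 being 3!.

    Goursat only says that differences of circle means tend to 0; that the means converge at all is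
    read off from small circles, where a Laurent-type expansion is known. A second obstacle is
    circularity: means of the derivative are needed before the derivative is known to be
    holomorphic.

    The extremal g has 1 + z g''/g' = alpha + (1 - alpha) (1 + z^2) / (1 - z^2), the equality case
    of Caratheodory's bound. Truncating its series avoids complex powers and convergence of series;
    the dilation r < 1 leaves room below the critical value -1/2 of Re(w / (1 - w)), and this room
    pays for the truncation error. The constant is thus approached by polynomial maps. *)

Section Norm.
Variable R : realType.
Implicit Types (V W : normedModType (C R)) (r s : R) (z w : C R).

Definition rc r : C R := (r%:C)%C.
Definition reC z : R := complex.Re (z : R[i]).
Definition imC z : R := complex.Im (z : R[i]).
Definition iC : C R := ('i)%C.

Lemma rcD r s : rc (r + s) = rc r + rc s.
Proof. exact: (rmorphD (real_complex R)). Qed.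
Lemma rcB r s : rc (r - s) = rc r - rc s.
Proof. exact: (rmorphB (real_complex R)). Qed.
Lemma rcM r s : rc (r * s) = rc r * rc s.
Proof. exact: (rmorphM (real_complex R)). Qed.
Lemma rc0 : rc 0 = 0. Proof. by []. Qed.
Lemma rc1 : rc 1 = 1. Proof. by []. Qed.
Lemma rc_nat k : rc k%:R = k%:R.
Proof. exact: (rmorph_nat (real_complex R)). Qed.
Lemma rcX r k : rc (r ^+ k) = rc r ^+ k.
Proof. exact: (rmorphXn (real_complex R)). Qed.
Lemma rcV r : rc (r^-1) = (rc r)^-1.
Proof. exact: (fmorphV (real_complex R)). Qed.
Lemma rc_inj : injective rc. Proof. by move=> r s []. Qed.
Lemma rc_eq0 r : (rc r == 0) = (r == 0).
Proof. by rewrite -rc0 (inj_eq rc_inj). Qed.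

Lemma reCD z w : reC (z + w) = reC z + reC w. Proof. by case: z w => [a b] []. Qed.
Lemma reCN z : reC (- z) = - reC z. Proof. by case: z. Qed.
Lemma reCB z w : reC (z - w) = reC z - reC w.
Proof. by rewrite reCD reCN. Qed.
Lemma reC_rc r : reC (rc r) = r. Proof. by []. Qed.
Lemma reC_rcM r z : reC (rc r * z) = r * reC z.
Proof. by case: z => a b; rewrite /reC /= mul0r subr0. Qed.
Lemma reC_sum (I : Type) (s : seq I) (P : pred I) (F : I -> C R) :
  reC (\sum_(i <- s | P i) F i) = \sum_(i <- s | P i) reC (F i).
Proof. exact: (big_morph _ reCD (erefl : reC 0 = 0)). Qed.
Lemma rc_sum (I : Type) (s : seq I) (P : pred I) (F : I -> R) :
  rc (\sum_(i <- s | P i) F i) = \sum_(i <- s | P i) rc (F i).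
Proof. exact: (big_morph _ rcD rc0). Qed.
Lemma C_split z : z = rc (reC z) + iC * rc (imC z).
Proof.
by case: z => a b; apply/eqP; rewrite eq_complex /=; apply/andP; split; apply/eqP; ring.
Qed.

Lemma norm_rnorm V (v : V) : `|v| = rc (rnorm v).
Proof.
have := normr_ge0 v; rewrite /rnorm /rc; case: (`|v|) => a b.
by rewrite lecE /= => /andP[/eqP -> _].
Qed.
Lemma le_rc r s : (rc r <= rc s) = (r <= s).
Proof. by rewrite /rc lecE /= eqxx. Qed.
Lemma lt_rc r s : (rc r < rc s) = (r < s).
Proof. by rewrite /rc ltcE /= eqxx. Qed.

Lemma rnorm_ge0 V (v : V) : 0 <= rnorm v.
Proof. by rewrite -le_rc rc0 -norm_rnorm normr_ge0. Qed.
Lemma rnorm0 V : rnorm (0 : V) = 0.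
Proof. by rewrite /rnorm normr0. Qed.
Lemma rnormD V (u v : V) : rnorm (u + v) <= rnorm u + rnorm v.
Proof. by rewrite -le_rc rcD -!norm_rnorm ler_normD. Qed.
Lemma rnormN V (v : V) : rnorm (- v) = rnorm v.
Proof. by rewrite /rnorm normrN. Qed.
Lemma rnormB V (u v : V) : rnorm (u - v) <= rnorm u + rnorm v.
Proof. by rewrite -(rnormN v) rnormD. Qed.
Lemma rnormBC V (u v : V) : rnorm (u - v) = rnorm (v - u).
Proof. by rewrite -rnormN opprB. Qed.
Lemma rnormZ V (a : C R) (v : V) : rnorm (a *: v) = rnorm a * rnorm v.
Proof. by apply: rc_inj; rewrite rcM -!norm_rnorm normrZ. Qed.
Lemma rnormM z w : rnorm (z * w) = rnorm z * rnorm w.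
Proof. by apply: rc_inj; rewrite rcM -!norm_rnorm normrM. Qed.
Lemma rnormV z : rnorm (z^-1) = (rnorm z)^-1.
Proof. by apply: rc_inj; rewrite rcV -!norm_rnorm normfV. Qed.
Lemma rnormX z k : rnorm (z ^+ k) = rnorm z ^+ k.
Proof. by apply: rc_inj; rewrite rcX -!norm_rnorm normrX. Qed.
Lemma rnorm1 : rnorm (1 : C R) = 1.
Proof. by apply: rc_inj; rewrite -!norm_rnorm normr1. Qed.
Lemma rnorm_eq0 V (v : V) : (rnorm v == 0) = (v == 0).
Proof. by rewrite -rc_eq0 -norm_rnorm normr_eq0. Qed.
Lemma rnorm_gt0 V (v : V) : (0 < rnorm v) = (v != 0).
Proof. by rewrite lt_def rnorm_ge0 rnorm_eq0 andbT. Qed.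
Lemma rnorm_rc r : rnorm (rc r) = `|r|.
Proof. by rewrite /rnorm normc_def /= expr0n /= addr0 sqrtr_sqr. Qed.
Lemma rnorm_iC : rnorm iC = 1.
Proof. by rewrite /rnorm normc_def /= expr0n /= add0r expr1n sqrtr1. Qed.
Lemma rnorm_sum V (I : Type) (s : seq I) (P : pred I) (F : I -> V) :
  rnorm (\sum_(i <- s | P i) F i) <= \sum_(i <- s | P i) rnorm (F i).
Proof.
elim/big_ind2: _ => [|u a v b ua vb|//]; first by rewrite rnorm0.
exact: le_trans (rnormD _ _) (lerD ua vb).
Qed.
Lemma rnorm_sqr z : rnorm z ^+ 2 = reC z ^+ 2 + imC z ^+ 2.
Proof.
rewrite /rnorm normc_def /= sqr_sqrtr ?addr_ge0 ?sqr_ge0 //.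
Qed.
Lemma reC_le z : `|reC z| <= rnorm z.
Proof.
rewrite -(@ler_pXn2r _ 2) ?nnegrE ?normr_ge0 ?rnorm_ge0 // rnorm_sqr.
by rewrite real_normK ?num_real // lerDl sqr_ge0.
Qed.
Lemma imC_le z : `|imC z| <= rnorm z.
Proof.
rewrite -(@ler_pXn2r _ 2) ?nnegrE ?normr_ge0 ?rnorm_ge0 // rnorm_sqr.
by rewrite real_normK ?num_real // lerDr sqr_ge0.
Qed.
Lemma rnorm_le z : rnorm z <= `|reC z| + `|imC z|.
Proof.
rewrite {1}[z]C_split; apply: le_trans (rnormD _ _) _.
by rewrite rnormM rnorm_iC mul1r !rnorm_rc.
Qed.
Lemma mul_conj z : z * z^* = rc (rnorm z ^+ 2).
Proof. by rewrite -normCK norm_rnorm rcX. Qed.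
Lemma rnorm_conj z : rnorm (z^*) = rnorm z.
Proof. by rewrite /rnorm norm_conjC. Qed.
Lemma reC_conj z : reC (z^*) = reC z.
Proof. by case: z. Qed.
Lemma add_conj z : z + z^* = rc (2 * reC z).
Proof. case: z => a b; apply/eqP; rewrite eq_complex /=; apply/andP; split; apply/eqP; ring. Qed.

Lemma rnorm_coord n (v : 'rV[C R]_n) k : rnorm (v 0 k) <= rnorm v.
Proof.
rewrite -le_rc -!norm_rnorm [leRHS]/Num.norm /= mx_normE.
have -> : v 0 k = v (ord0 : 'I_1, k).1 (ord0 : 'I_1, k).2 by [].
by rewrite -[leLHS]nngE num_le; exact: le_bigmax.
Qed.
Lemma rnorm_rV_le n (v : 'rV[C R]_n) r :
  0 <= r -> (forall k, rnorm (v 0 k) <= r) -> rnorm v <= r.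
Proof.
move=> r0 H; rewrite -le_rc -norm_rnorm [leLHS]/Num.norm /=.
have [->|/mx_norm_neq0[[i k]] /= ->] := eqVneq (mx_norm v) 0; first by rewrite -rc0 le_rc.
by rewrite ord1 norm_rnorm le_rc.
Qed.

(** Real radii and a bare function [L] keep filters and [C R]-valued norms out of the estimates, and
    allow [L] to be a limit whose linearity is established separately. *)
Definition has_diff_eps V W (f : V -> W) (x : V) (L : V -> W) :=
  forall e : R, 0 < e -> exists2 d : R, 0 < d & forall h, rnorm h < d ->
    rnorm (f (x + h) - f x - L h) <= e * rnorm h.

(** The partial order of [C R] compares only numbers with equal imaginary parts, so the radii in the
    library's filters are real numbers in disguise. *)
Lemma gt0_rc (e : C R) : 0 < e -> e = rc (reC e) /\ 0 < reC e.
Proof. by case: e => a b; rewrite ltcE /= => /andP[/eqP -> a0]. Qed.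

Lemma near0_rnorm V (P : V -> Prop) :
  (\forall h \near (0 : V), P h) <-> exists2 d : R, 0 < d & forall h, rnorm h < d -> P h.
Proof.
split=> [/nbhs_ballP[e /gt0_rc[-> e0]] H|[d d0 H]].
  exists (reC e) => // h hd; apply: H; rewrite -ball_normE /=.
  by rewrite sub0r normrN norm_rnorm lt_rc.
apply/nbhs_ballP; exists (rc d); first by rewrite /= -rc0 lt_rc.
by move=> h; rewrite -ball_normE /= sub0r normrN norm_rnorm lt_rc; exact: H.
Qed.

Lemma has_diff_epsP V W (f : V -> W) x (L : V -> W) :
  f \o shift x = cst (f x) + L +o_ 0 id <-> has_diff_eps f x L.
Proof.
rewrite (eqaddoP _ (f \o shift x) (cst (f x) + L) id).
split=> [H e e0|H e /gt0_rc[-> e0]].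
  have e0' : 0 < rc e by rewrite -rc0 lt_rc.
  apply/near0_rnorm; have := H _ e0'; apply: filterS => h.
  rewrite !norm_rnorm -rcM le_rc /= !fctE /=.
  by rewrite opprD addrA (addrC h).
have /near0_rnorm := H _ e0; apply: filterS => h.
by rewrite !norm_rnorm -rcM le_rc /= !fctE /= opprD addrA (addrC h).
Qed.

Lemma diff_has_diff_eps V W (f : V -> W) x : differentiable f x -> has_diff_eps f x ('d f x).
Proof. by move=> /diff_locally /has_diff_epsP. Qed.

Lemma cvg_rnorm V W (f : V -> W) x :
  {for x, continuous f} <->
  forall e : R, 0 < e -> exists2 d : R, 0 < d & forall h, rnorm h < d -> rnorm (f (x + h) - f x) <= e.
Proof.
split=> [/cvgrPdist_le H e e0|H].
  have e0' : 0 < rc e by rewrite -rc0 lt_rc.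
  have /nbhs0P/near0_rnorm[d d0 D] := H _ e0'; exists d => // h /D.
  by rewrite norm_rnorm le_rc rnormBC.
apply/cvgrPdist_le => e /gt0_rc[-> e0].
apply/nbhs0P/near0_rnorm; have [d d0 D] := H _ e0; exists d => // h /D.
by rewrite norm_rnorm le_rc rnormBC.
Qed.

Lemma linear_bounded_continuous V W (L : {linear V -> W}) k :
  (forall h, rnorm (L h) <= k * rnorm h) -> continuous L.
Proof.
move=> H x; apply/cvg_rnorm => e e0.
have k1 : 0 < `|k| + 1 by rewrite ltr_wpDl.
exists (e / (`|k| + 1)); first exact: divr_gt0.
move=> h; rewrite ltr_pdivlMr // => /ltW hd.
rewrite linearD addrC addKr; apply: le_trans (H h) (le_trans _ hd).
by rewrite mulrC ler_wpM2l ?rnorm_ge0 //; apply: le_trans (ler_norm _) _; rewrite lerDl.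
Qed.

(** The bound by [k] makes [L] continuous, and uniqueness of continuous differentials then
    identifies it with ['d f x]. *)
Lemma has_diff_eps_diff V W (f : V -> W) x (L : {linear V -> W}) k :
  (forall h, rnorm (L h) <= k * rnorm h) -> has_diff_eps f x L ->
  differentiable f x /\ 'd f x = L :> (V -> W).
Proof.
move=> /linear_bounded_continuous cL /has_diff_epsP H.
have E := diff_unique cL H; split=> //.
by apply/diff_locallyP; rewrite E.
Qed.
End Norm.

(** * Discrete Goursat theorem *)

Section Goursat.
Variable R : realType.
Implicit Types (H : C R -> C R) (c d : C R) (m : nat) (a b x y : R).

(** Every right end bounds every left end, so the supremum of the left ends [u k] lies in all the
    intervals. *)
Lemma nested_intervals (u : nat -> R) a :
  (forall k, u k <= u k.+1 /\ u k.+1 + a / 2 ^+ k.+1 <= u k + a / 2 ^+ k) ->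
  0 <= a -> exists s, forall k, u k <= s /\ s <= u k + a / 2 ^+ k.
Proof.
move=> H a0.
have mono k j : (k <= j)%N -> u k <= u j /\ u j + a / 2 ^+ j <= u k + a / 2 ^+ k.
  move=> /subnK <-; elim: (j - k)%N => [|i [I1 I2]]; first by split.
  rewrite addSn; have [H1 H2] := H (i + k)%N.
  by split; [exact: le_trans I1 H1|exact: le_trans H2 I2].
have pos k : 0 <= a / 2 ^+ k by rewrite divr_ge0 // exprn_ge0.
have ub k j : u j <= u k + a / 2 ^+ k.
  have [/mono[_ H1]|/ltnW/mono[H1 _]] := leqP k j.
    by apply: le_trans H1; rewrite lerDl.
  by apply: le_trans H1 _; rewrite lerDl.
exists (sup (range u)) => k; split.
  apply: ub_le_sup; last by exists k.
  by exists (u 0%N + a / 2 ^+ 0) => _ [j _ <-].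
by apply: ge_sup; [exists (u 0%N); exists 0%N|move=> _ [j _ <-]].
Qed.

(** An abstract [P] lets the bisection serve twice: on rectangles in [goursat], and with height 0,
    as bisection of an interval, in [mean_value_ineq]. *)
Lemma nested_rectangles (P : R -> R -> R -> R -> Prop) x0 y0 a0 b0 :
  0 <= a0 -> 0 <= b0 -> P x0 y0 a0 b0 ->
  (forall x y a b, P x y a b ->
    exists x' y', [/\ P x' y' (a / 2) (b / 2), x' = x \/ x' = x + a / 2 &
                      y' = y \/ y' = y + b / 2]) ->
  exists s t, forall k, exists x y,
    [/\ P x y (a0 / 2 ^+ k) (b0 / 2 ^+ k),
        [/\ x0 <= x, x <= s, s <= x + a0 / 2 ^+ k & x + a0 / 2 ^+ k <= x0 + a0] &
        [/\ y0 <= y, y <= t, t <= y + b0 / 2 ^+ k & y + b0 / 2 ^+ k <= y0 + b0]].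
Proof.
move=> ha hb P0 step.
pose Q k (p : R * R) := P p.1 p.2 (a0 / 2 ^+ k) (b0 / 2 ^+ k).
have half (c : R) k : c / 2 ^+ k / 2 = c / 2 ^+ k.+1.
  by rewrite exprSr invfM mulrA.
(* The hypothesis [Q] sits under the existential so that [choice] yields a total function; its value
   is 0 where [Q] fails. *)
have st (kp : nat * (R * R)) : exists q : R * R, Q kp.1 kp.2 ->
    [/\ Q kp.1.+1 q, q.1 = kp.2.1 \/ q.1 = kp.2.1 + a0 / 2 ^+ kp.1.+1 &
        q.2 = kp.2.2 \/ q.2 = kp.2.2 + b0 / 2 ^+ kp.1.+1].
  case: kp => k [x y] /=.
  have [/step[x' [y' [H1 H2 H3]]]|nq] := pselect (Q k (x, y)); last by exists 0.
  by exists (x', y') => _; rewrite /Q /= -!half.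
have [F HF] := choice st.
pose u := fix u k : R * R := if k is j.+1 then F (j, u j) else (x0, y0).
have Qu k : Q k (u k).
  elim: k => [|k IH]; first by rewrite /Q /= expr0 !divr1.
  by have [] := HF (k, u k) IH.
have dbl (c : R) k : c / 2 ^+ k = c / 2 ^+ k.+1 + c / 2 ^+ k.+1.
  by rewrite -half -splitr.
have n1 k : (u k).1 <= (u k.+1).1 /\ (u k.+1).1 + a0 / 2 ^+ k.+1 <= (u k).1 + a0 / 2 ^+ k.
  have p : 0 <= a0 / 2 ^+ k.+1 by rewrite divr_ge0 // exprn_ge0.
  rewrite (dbl _ k); have [_ + _] := HF (k, u k) (Qu k); rewrite -/(u k.+1) /= => -[] ->; lra.
have n2 k : (u k).2 <= (u k.+1).2 /\ (u k.+1).2 + b0 / 2 ^+ k.+1 <= (u k).2 + b0 / 2 ^+ k.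
  have p : 0 <= b0 / 2 ^+ k.+1 by rewrite divr_ge0 // exprn_ge0.
  rewrite (dbl _ k); have [_ _] := HF (k, u k) (Qu k); rewrite -/(u k.+1) /= => -[] ->; lra.
have mono (v : nat -> R) (c : R) : (forall k, v k <= v k.+1 /\ v k.+1 + c / 2 ^+ k.+1 <= v k + c / 2 ^+ k) ->
    forall k, v 0%N <= v k /\ v k + c / 2 ^+ k <= v 0%N + c.
  move=> Hv; elim=> [|k [I1 I2]]; first by rewrite expr0 divr1.
  by have [J1 J2] := Hv k; split; [exact: le_trans I1 J1|exact: le_trans J2 I2].
have [s Hs] := nested_intervals n1 ha; have [t Ht] := nested_intervals n2 hb.
exists s, t => k; exists (u k).1, (u k).2.
have [? ?] := Hs k; have [? ?] := Ht k.
have [? ?] := mono _ _ n1 k; have [? ?] := mono _ _ n2 k.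
by split => //; exact: Qu.
Qed.

(* Left Riemann sum, with [2 ^ m] nodes, of the integral of [H] over [[c, c + d]]. *)
Definition side m H c d :=
  d / 2 ^+ m * \sum_(k < 2 ^ m) H (c + d * rc (k%:R / 2 ^+ m)).

Lemma sideS m H c d : side m.+1 H c d = side m H c (d / 2) + side m H (c + d / 2) (d / 2).
Proof.
have n2 : (2 : C R) != 0 by rewrite pnatr_eq0.
have m2 : (2 : C R) ^+ m != 0 by rewrite expf_neq0.
have r2 : (2 : R) ^+ m != 0 by rewrite expf_neq0 ?pnatr_eq0.
rewrite /side expnS mul2n -addnn big_split_ord /= mulrDr.
have -> : d / 2 ^+ m.+1 = d / 2 / 2 ^+ m by rewrite exprS; field.
congr (_ * _ + _ * _); apply: eq_bigr => k _; congr (H _).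
  by rewrite exprS !rcM !rcV !rcM rcX !rc_nat; field.
by rewrite natrD natrX exprS !rcM !rcV !rcD !rcM !rcX !rc_nat; field.
Qed.

Lemma side_bound m H c d (M : R) :
  (forall t, 0 <= t <= 1 -> rnorm (H (c + d * rc t)) <= M) ->
  rnorm (side m H c d) <= rnorm d * M.
Proof.
move=> HM; have p : (0 : R) < 2 ^+ m by rewrite exprn_gt0.
rewrite /side !rnormM rnormV rnormX -(rc_nat _ 2) rnorm_rc ger0_norm //.
rewrite -mulrA ler_wpM2l ?rnorm_ge0 // mulrC ler_pdivrMr //.
apply: le_trans (rnorm_sum _ _ _) _.
apply: (@le_trans _ _ (\sum_(k < 2 ^ m) M)).
  apply: ler_sum => k _; apply: HM.
  rewrite divr_ge0 ?ler0n ?(ltW p) //= ler_pdivrMr // mul1r -natrX ler_nat.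
  by rewrite ltnW.
by rewrite sumr_const card_ord -(mulr_natr M) natrX.
Qed.

Lemma side_add m H1 H2 c d :
  side m (fun z => H1 z + H2 z) c d = side m H1 c d + side m H2 c d.
Proof. by rewrite /side big_split /= mulrDr. Qed.

(** Left sums do not integrate affine functions exactly, but translating the side by [e] changes the
    integrand by the constant [q * e], which they do integrate exactly. Opposite sides of a
    rectangle therefore carry the same error. *)
Lemma side_affine m (p q e : C R) c d :
  side m (fun z => p + q * z) (c + e) d - side m (fun z => p + q * z) c d = d * q * e.
Proof.
rewrite /side -mulrBr -sumrB.
rewrite (eq_bigr (fun=> q * e)); last by move=> k _; ring.
rewrite sumr_const card_ord -(mulr_natr (q * e)) natrX.
by field; rewrite expf_neq0 ?pnatr_eq0.
Qed.

(** Opposite sides are run in the same direction and subtracted. Running them backwards would move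
    the nodes to the other ends of the subintervals, and the inner sides would no longer cancel
    exactly in [contourS]. *)
Definition contour m H c a b :=
  side m H c (rc a) + side m H (c + rc a) (iC R * rc b)
  - side m H (c + iC R * rc b) (rc a) - side m H c (iC R * rc b).

Lemma contourS m H c a b : contour m.+1 H c a b =
  contour m H c (a / 2) (b / 2) + contour m H (c + rc (a / 2)) (a / 2) (b / 2)
  + contour m H (c + iC R * rc (b / 2)) (a / 2) (b / 2)
  + contour m H (c + rc (a / 2) + iC R * rc (b / 2)) (a / 2) (b / 2).
Proof.
have e2 (r : R) : rc r / 2 = rc (r / 2) by rewrite rcM rcV rc_nat.
have d2 (r : R) : rc r = rc (r / 2) + rc (r / 2) by rewrite -rcD -splitr.
rewrite /contour !sideS -!(mulrA (iC R)) !e2 (d2 a) (d2 b) mulrDr !addrA.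
set u := rc (a / 2); set v := iC R * rc (b / 2).
by rewrite !(addrAC _ v u); ring.
Qed.

Lemma contour_add m H1 H2 c a b :
  contour m (fun z => H1 z + H2 z) c a b = contour m H1 c a b + contour m H2 c a b.
Proof. rewrite /contour !side_add; ring. Qed.

Lemma contour_affine m (p q : C R) c a b : contour m (fun z => p + q * z) c a b = 0.
Proof.
have -> : contour m (fun z => p + q * z) c a b =
  (side m (fun z => p + q * z) (c + rc a) (iC R * rc b) -
   side m (fun z => p + q * z) c (iC R * rc b)) -
  (side m (fun z => p + q * z) (c + iC R * rc b) (rc a) -
   side m (fun z => p + q * z) c (rc a)) by rewrite /contour; ring.
by rewrite !side_affine; ring.
Qed.

Definition pt x y : C R := rc x + iC R * rc y.

Lemma reC_pt x y : reC (pt x y) = x. Proof. by rewrite /reC /=; ring. Qed.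
Lemma imC_pt x y : imC (pt x y) = y. Proof. by rewrite /imC /=; ring. Qed.
Lemma iC_rc y : iC R * rc y = pt 0 y. Proof. by rewrite /pt rc0 add0r. Qed.

Lemma contour_bound m H x y a b (M : R) : 0 <= a -> 0 <= b ->
  (forall s t, x <= s <= x + a -> y <= t <= y + b -> rnorm (H (pt s t)) <= M) ->
  rnorm (contour m H (pt x y) a b) <= 2 * (a + b) * M.
Proof.
move=> a0 b0 HM.
have ab t (r : R) : 0 <= t <= 1 -> 0 <= r -> 0 <= r * t <= r.
  by move=> /andP[t0 t1] r0; rewrite mulr_ge0 //= ler_piMr.
have e1 (p q r t : R) : pt p q + rc r * rc t = pt (p + r * t) q.
  by rewrite /pt rcD rcM; ring.
have e2 (p q r t : R) : pt p q + iC R * rc r * rc t = pt p (q + r * t).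
  by rewrite /pt rcD rcM; ring.
have f1 (p q r : R) : pt p q + rc r = pt (p + r) q by rewrite /pt rcD; ring.
have f2 (p q r : R) : pt p q + iC R * rc r = pt p (q + r) by rewrite /pt rcD; ring.
have na : rnorm (rc a) = a by rewrite rnorm_rc ger0_norm.
have nb : rnorm (iC R * rc b) = b by rewrite rnormM rnorm_iC mul1r rnorm_rc ger0_norm.
rewrite /contour f1 f2.
have B1 : rnorm (side m H (pt x y) (rc a)) <= a * M.
  rewrite -{2}na; apply: side_bound => t /ab/(_ a0)/andP[? ?].
  rewrite e1; apply: HM; lra.
have B2 : rnorm (side m H (pt (x + a) y) (iC R * rc b)) <= b * M.
  rewrite -{2}nb; apply: side_bound => t /ab/(_ b0)/andP[? ?].
  rewrite e2; apply: HM; lra.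
have B3 : rnorm (side m H (pt x (y + b)) (rc a)) <= a * M.
  rewrite -{2}na; apply: side_bound => t /ab/(_ a0)/andP[? ?].
  rewrite e1; apply: HM; lra.
have B4 : rnorm (side m H (pt x y) (iC R * rc b)) <= b * M.
  rewrite -{2}nb; apply: side_bound => t /ab/(_ b0)/andP[? ?].
  rewrite e2; apply: HM; lra.
apply: le_trans (rnormB _ _) _; apply: le_trans (lerD (rnormB _ _) (lexx _)) _.
apply: le_trans (lerD (lerD (rnormD _ _) (lexx _)) (lexx _)) _; lra.
Qed.

Lemma diff_C1 H z h : differentiable H z -> 'd H z h = 'd H z 1 * h.
Proof.
by move=> _; rewrite -{1}(mulr1 h) -[h * 1]/(h *: (1 : C R)) linearZ mulrC.
Qed.

Lemma rnorm_pt x y : rnorm (pt x y) <= `|x| + `|y|.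
Proof.
apply: le_trans (rnormD _ _) _.
by rewrite rnormM rnorm_iC mul1r !rnorm_rc.
Qed.

Lemma div_expr2_small a (d : R) : 0 <= a -> 0 < d -> exists k, a / 2 ^+ k < d.
Proof.
move=> a0 d0; have [k] : exists k : nat, a / d < k%:R.
  exists (Num.trunc (a / d)).+1; exact: truncnS_gt.
move=> H; exists k; rewrite ltr_pdivrMr ?exprn_gt0 // mulrC -ltr_pdivrMr //.
by apply: lt_le_trans H _; rewrite -natrX ler_nat ltnW // ltn_expl.
Qed.

(** The error is measured per unit of area, with density [K]: such a bound adds up over four
    quarters, so if it fails on a rectangle it fails on a quarter. At the common point of the
    quarters the affine part of [H] has contour sum 0, and the remainder contradicts the failure. *)
Lemma goursat H x0 y0 a0 b0 : 0 < a0 -> 0 < b0 ->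
  (forall x y, x0 <= x <= x0 + a0 -> y0 <= y <= y0 + b0 -> differentiable H (pt x y)) ->
  forall e, 0 < e -> exists M, forall m, (M <= m)%N ->
    rnorm (contour m H (pt x0 y0) a0 b0) <= e.
Proof.
move=> ha hb dH e e0.
pose K := e / (a0 * b0).
have K0 : 0 < K by rewrite divr_gt0 // mulr_gt0.
pose P x y a b := ~ exists M, forall m, (M <= m)%N ->
    rnorm (contour m H (pt x y) a b) <= K * (a * b).
apply: contrapT => nH.
have P0 : P x0 y0 a0 b0.
  by rewrite /P /K divfK // mulf_neq0 ?gt_eqF.
have e1 (p q r : R) : pt p q + rc r = pt (p + r) q by rewrite /pt rcD; ring.
have e2 (p q r : R) : pt p q + iC R * rc r = pt p (q + r) by rewrite /pt rcD; ring.
have step x y a b : P x y a b ->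
    exists x' y', [/\ P x' y' (a / 2) (b / 2), x' = x \/ x' = x + a / 2 &
                      y' = y \/ y' = y + b / 2].
  move=> Pq; apply: contrapT => nx; apply: Pq.
  have Q x' y' : (x' = x \/ x' = x + a / 2) -> (y' = y \/ y' = y + b / 2) ->
      exists M, forall m, (M <= m)%N ->
        rnorm (contour m H (pt x' y') (a / 2) (b / 2)) <= K * (a / 2 * (b / 2)).
    by move=> hx hy; apply: contrapT => np; apply: nx; exists x', y'.
  have [M1 H1] := Q x y (or_introl erefl) (or_introl erefl).
  have [M2 H2] := Q (x + a / 2) y (or_intror erefl) (or_introl erefl).
  have [M3 H3] := Q x (y + b / 2) (or_introl erefl) (or_intror erefl).
  have [M4 H4] := Q (x + a / 2) (y + b / 2) (or_intror erefl) (or_intror erefl).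
  (* The successor is due to [contourS], where level [m.+1] on the rectangle is level [m] on its
     quarters. *)
  exists (maxn (maxn M1 M2) (maxn M3 M4)).+1 => -[//|m].
  rewrite ltnS !geq_max => /andP[/andP[/H1 B1 /H2 B2] /andP[/H3 B3 /H4 B4]].
  rewrite contourS !e1 !e2.
  apply: le_trans (rnormD _ _) _; apply: le_trans (lerD (rnormD _ _) (lexx _)) _.
  apply: le_trans (lerD (lerD (rnormD _ _) (lexx _)) (lexx _)) _.
  lra.
have [s [t st]] := nested_rectangles (ltW ha) (ltW hb) P0 step.
have [? [? [_ [? ? ? ?] [? ? ? ?]]]] := st 0%N.
have dst : differentiable H (pt s t) by apply: dH; lra.
(* A remainder [eta * (a + b)] on a contour of length [2 * (a + b)] gives [2 * eta * (a + b) ^+ 2],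
   which is exactly [K * (a * b)] since all quarters have the shape of the first rectangle. *)
pose eta := K * (a0 * b0) / (2 * (a0 + b0) ^+ 2).
have ab0 : 0 < a0 + b0 by rewrite addr_gt0.
have eta0 : 0 < eta.
  by apply: divr_gt0; [do 2 (apply: mulr_gt0 => //)|apply: mulr_gt0 => //; exact: exprn_gt0].
have [d dp Hd] := diff_has_diff_eps dst eta0.
have [k Hk] := div_expr2_small (ltW ab0) dp.
have := st k; set a := a0 / 2 ^+ k; set b := b0 / 2 ^+ k.
move=> [x [y [nP [? ? ? ?] [? ? ? ?]]]].
(* On a small enough rectangle the bound holds at every level, not just eventually. *)
apply: nP; exists 0%N => m _.
have p2 : (0 : R) < 2 ^+ k by rewrite exprn_gt0.
have pa : 0 <= a by rewrite divr_ge0 ?ltW.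
have pb : 0 <= b by rewrite divr_ge0 ?ltW.
have abk : (a0 + b0) / 2 ^+ k = a + b by rewrite mulrDl.
pose D := 'd H (pt s t) 1.
pose aff z := (H (pt s t) - D * pt s t) + D * z.
have -> : H = (fun z => aff z + (H z - aff z)) by apply/funext => z; ring.
rewrite contour_add contour_affine add0r.
have -> : K * (a * b) = 2 * (a + b) * (eta * (a + b)).
  by rewrite -abk /a /b /eta; field; rewrite !gt_eqF.
apply: contour_bound => // p q hp hq.
have hpt : rnorm (pt (p - s) (q - t)) <= a + b.
  apply: le_trans (rnorm_pt _ _) (lerD _ _); rewrite ler_norml; lra.
have := Hd (pt (p - s) (q - t)).
rewrite diff_C1 // -/D.
have -> : pt s t + pt (p - s) (q - t) = pt p q by rewrite /pt !rcB; ring.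
have -> : H (pt p q) - H (pt s t) - D * pt (p - s) (q - t) = H (pt p q) - aff (pt p q).
  by rewrite /aff /pt !rcB; ring.
move=> /(_ (le_lt_trans hpt _)) HH; apply: le_trans (HH _) _; first by rewrite -abk.
by rewrite ler_wpM2l // ltW.
Qed.
End Goursat.

(** * The complex exponential and its differentiability *)

Section Exponential.
Variable R : realType.
Implicit Types (G : C R -> C R) (z w : C R) (m : nat) (r t : R).

Lemma is_derive_eps (f : R -> R) (x df : R) : is_derive x 1 f df ->
  forall e : R, 0 < e -> exists2 d : R, 0 < d &
    forall h, `|h| < d -> `|f (x + h) - f x - df * h| <= e * `|h|.
Proof.
move=> [dv <-] e e0; have df' : differentiable f x by apply/derivable1_diffP.
have := diff_locally df'.
rewrite (eqaddoP _ (f \o shift x) (cst (f x) + 'd f x) id) => /(_ _ e0).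
move=> /nbhs_ballP[d d0 H]; exists d => // h hd.
have := H h; rewrite -ball_normE /= sub0r normrN => /(_ hd).
rewrite !fctE /= opprD addrA (addrC h) deriveE //.
have -> : 'd f x h = 'd f x 1 * h; last by [].
by rewrite mulrC -[RHS]/(h *: 'd f x 1) -linearZ /= /GRing.scale /= mulr1.
Qed.

Definition cexp w : C R := rc (expR (reC w)) * pt (cos (imC w)) (sin (imC w)).

Lemma cexpD z w : cexp (z + w) = cexp z * cexp w.
Proof.
case: z w => [a b] [c d]; rewrite /cexp /reC /imC /= expRD cosD sinD.
by rewrite /pt; apply/eqP; rewrite eq_complex /=; apply/andP; split; apply/eqP; ring.
Qed.
Lemma cexp0 : cexp 0 = 1.
Proof.
rewrite /cexp /reC /imC /= expR0 cos0 sin0.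
by apply/eqP; rewrite eq_complex /=; apply/andP; split; apply/eqP; ring.
Qed.
Lemma rnorm_cexp w : rnorm (cexp w) = expR (reC w).
Proof.
rewrite /cexp rnormM rnorm_rc ger0_norm ?expR_ge0 //.
suff -> : rnorm (pt (cos (imC w)) (sin (imC w))) = 1 by rewrite mulr1.
apply/eqP; rewrite -(@eqrXn2 _ 2) ?rnorm_ge0 // rnorm_sqr expr1n.
by rewrite reC_pt imC_pt cos2Dsin2.
Qed.
Lemma cexp_neq0 w : cexp w != 0.
Proof. by rewrite -rnorm_gt0 rnorm_cexp expR_gt0. Qed.

Lemma cexp_expansion (e : R) : 0 < e -> exists2 d : R, 0 < d & forall h : C R, rnorm h < d ->
  rnorm (cexp h - 1 - h) <= e * rnorm h.
Proof.
(* The real part will cost [4 * (e1 * n)] and the imaginary part [5 * (e1 * n)], where [n] is the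
   norm of [h]. Requiring also [n < e1] turns the product [n * n] into [e1 * n]. *)
move=> e0; pose e1 := Num.min (e / 9) 1.
have e10 : 0 < e1 by rewrite lt_min ltr01 divr_gt0.
have e11 : e1 <= 1 by rewrite ge_min lexx orbT.
have e19 : e1 <= e / 9 by rewrite ge_min lexx.
clearbody e1.
have [d1 p1 H1] := is_derive_eps (is_derive_expR (0 : R)) e10.
have [d2 p2 H2] := is_derive_eps (is_derive_cos (0 : R)) e10.
have [d3 p3 H3] := is_derive_eps (is_derive_sin (0 : R)) e10.
exists (Num.min e1 (Num.min d1 (Num.min d2 d3))); first by rewrite !lt_min e10 p1 p2 p3.
move=> h; rewrite !lt_min => /and4P[he h1 h2 h3].
set s := reC h; set t := imC h; set n := rnorm h in he h1 h2 h3 *.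
have sn : `|s| <= n by exact: reC_le.
have tn : `|t| <= n by exact: imC_le.
have n0 : 0 <= n by exact: rnorm_ge0.
have := H1 s (le_lt_trans sn h1); have := H2 t (le_lt_trans tn h2).
have := H3 t (le_lt_trans tn h3); rewrite !add0r expR0 cos0 sin0 oppr0 mul0r !mul1r subr0 addr0.
set ga := sin t - t; set be := cos t - 1; set al := expR s - 1 - s => Hg Hb Ha.
have En : e1 * `|s| <= e1 * n by rewrite ler_wpM2l // ltW.
have Et : e1 * `|t| <= e1 * n by rewrite ler_wpM2l // ltW.
have nn : n * n <= e1 * n by rewrite ler_wpM2r // ltW.
have e1n : e1 * n <= n by rewrite ler_piMl.
have ga' : `|ga| <= e1 * n by exact: le_trans Hg Et.
have be' : `|be| <= e1 * n by exact: le_trans Hb Et.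
have al' : `|al| <= e1 * n by exact: le_trans Ha En.
have bd : `|1 + s + al| <= 3.
  apply: le_trans (ler_normD _ _) _; apply: le_trans (lerD (ler_normD _ _) (lexx _)) _.
  rewrite normr1; lra.
have re : reC (cexp h - 1 - h) = al + be * (1 + s + al).
  rewrite !reCB /cexp reC_rcM -/s -/t reC_pt.
  by rewrite -/(rc 1) reC_rc /al /be; ring.
have imE : imC (cexp h - 1 - h) = ga * (1 + s + al) + t * (s + al).
  have -> : imC (cexp h - 1 - h) = expR s * sin t - t.
    by rewrite /cexp /s /t; case: (h) => a b; rewrite /imC /reC /=; ring.
  by rewrite /ga /al; ring.
apply: le_trans (rnorm_le _) _; rewrite re imE.
have A1 : `|al + be * (1 + s + al)| <= e1 * n + e1 * n * 3.
  apply: le_trans (ler_normD _ _) (lerD al' _).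
  by rewrite normrM; apply: ler_pM.
have A2 : `|ga * (1 + s + al) + t * (s + al)| <= e1 * n * 3 + n * (n + n).
  apply: le_trans (ler_normD _ _) (lerD _ _).
    by rewrite normrM; apply: ler_pM.
  rewrite normrM; apply: ler_pM => //; apply: le_trans (ler_normD _ _) (lerD sn _).
  exact: le_trans al' e1n.
apply: le_trans (lerD A1 A2) _.
have : e1 * n <= e / 9 * n by rewrite ler_wpM2r.
rewrite mulrDr; lra.
Qed.

Lemma differentiable_cexp w : differentiable cexp w.
Proof.
have HH : has_diff_eps cexp w ( *:%R (cexp w)).
  move=> e e0; have c0 : 0 < rnorm (cexp w) by rewrite rnorm_gt0 cexp_neq0.
  have [d d0 H] := cexp_expansion (divr_gt0 e0 c0).
  exists d => // h /H Hh; rewrite cexpD.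
  have -> : cexp w * cexp h - cexp w - cexp w *: h = cexp w * (cexp h - 1 - h).
    by rewrite /GRing.scale /=; ring.
  by rewrite rnormM -ler_pdivlMl // mulrA (mulrC _ e).
have [] // := @has_diff_eps_diff _ _ _ cexp w ( *:%R (cexp w)) (rnorm (cexp w)) _ HH.
by move=> h /=; rewrite rnormZ.
Qed.
End Exponential.

(** * Means over circles *)

Section Averages.
Variable R : realType.
Implicit Types (G : C R -> C R) (z w c : C R) (m : nat) (r t : R).

Definition cconverges (u : nat -> C R) l := forall e : R, 0 < e ->
  exists M, forall m, (M <= m)%N -> rnorm (u m - l) <= e.

Lemma ccvg_le u l (K : R) M0 : cconverges u l ->
  (forall m, (M0 <= m)%N -> rnorm (u m) <= K) -> rnorm l <= K.
Proof.
move=> ul H; apply/ler_addgt0Pr => e e0.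
have [M HM] := ul e e0; set m := maxn M M0.
have -> : l = u m - (u m - l) by ring.
apply: le_trans (rnormB _ _) (lerD (H _ _) (HM _ _)); rewrite /m ?leq_maxr ?leq_maxl //.
Qed.

Lemma ccvg_unique u l l' : cconverges u l -> cconverges u l' -> l = l'.
Proof.
move=> H H'; apply/eqP; rewrite -subr_eq0 -rnorm_eq0 eq_le rnorm_ge0 andbT.
apply/ler_addgt0Pr => e e0; rewrite add0r.
have e2 : 0 < e / 2 by rewrite divr_gt0.
have [M HM] := H _ e2; have [M' HM'] := H' _ e2.
have -> : l - l' = (u (maxn M M') - l') - (u (maxn M M') - l) by ring.
apply: le_trans (rnormB _ _) _; rewrite [leRHS]splitr.
by apply: lerD; [apply: HM'; rewrite leq_maxr|apply: HM; rewrite leq_maxl].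
Qed.

Lemma ccvgD u v l l' : cconverges u l -> cconverges v l' -> cconverges (fun m => u m + v m) (l + l').
Proof.
move=> H H' e e0; have e2 : 0 < e / 2 by rewrite divr_gt0.
have [M HM] := H _ e2; have [M' HM'] := H' _ e2; exists (maxn M M') => m.
rewrite geq_max => /andP[/HM a /HM' b].
have -> : u m + v m - (l + l') = (u m - l) + (v m - l') by ring.
by apply: le_trans (rnormD _ _) _; rewrite [leRHS]splitr lerD.
Qed.

Lemma ccvgZ u l c : cconverges u l -> cconverges (fun m => c * u m) (c * l).
Proof.
move=> H e e0; have k0 : 0 < rnorm c + 1 by rewrite ltr_wpDl ?rnorm_ge0.
have [M HM] := H _ (divr_gt0 e0 k0); exists M => m /HM Hm.
rewrite -mulrBr rnormM; apply: (@le_trans _ _ ((rnorm c + 1) * (e / (rnorm c + 1)))).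
  by apply: ler_pM => //; rewrite ?rnorm_ge0 // lerDl.
by rewrite mulrC divfK // gt_eqF.
Qed.

Lemma ccvg_conj u l : cconverges u l -> cconverges (fun m => (u m)^* ) (l^* ).
Proof.
move=> H e /H[M HM]; exists M => m /HM.
by rewrite -rmorphB rnorm_conj.
Qed.

Definition circ t : C R := cexp (iC R * rc (2 * pi * t)).

Lemma rnorm_circ t : rnorm (circ t) = 1.
Proof.
by rewrite /circ rnorm_cexp iC_rc reC_pt expR0.
Qed.

Definition mean m r G := (\sum_(k < 2 ^ m) G (rc r * circ (k%:R / 2 ^+ m))) / 2 ^+ m.

Lemma rnorm_circM r t : 0 <= r -> rnorm (rc r * circ t) = r.
Proof. by move=> r0; rewrite rnormM rnorm_circ rnorm_rc ger0_norm // mulr1. Qed.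

Lemma mean_bound m r G (M : R) : 0 <= r ->
  (forall z, rnorm z = r -> rnorm (G z) <= M) -> rnorm (mean m r G) <= M.
Proof.
move=> r0 H; have p : (0 : R) < 2 ^+ m by rewrite exprn_gt0.
rewrite /mean rnormM rnormV rnormX -(rc_nat _ 2) rnorm_rc ger0_norm // ler_pdivrMr //.
apply: le_trans (rnorm_sum _ _ _) _.
apply: (@le_trans _ _ (\sum_(k < 2 ^ m) M)).
  by apply: ler_sum => k _; apply: H; rewrite rnorm_circM.
by rewrite sumr_const card_ord -(mulr_natr M) natrX.
Qed.

Lemma meanD m r G1 G2 : mean m r (fun z => G1 z + G2 z) = mean m r G1 + mean m r G2.
Proof. by rewrite /mean big_split mulrDl. Qed.
Lemma meanZ m r c G : mean m r (fun z => c * G z) = c * mean m r G.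
Proof. by rewrite /mean -mulr_sumr mulrA. Qed.
Lemma meanB m r G1 G2 : mean m r (fun z => G1 z - G2 z) = mean m r G1 - mean m r G2.
Proof. by rewrite /mean sumrB mulrBl. Qed.
Lemma mean_cst m r c : mean m r (fun=> c) = c.
Proof.
rewrite /mean sumr_const card_ord -(mulr_natr c) natrX.
by apply: mulfK; rewrite expf_neq0 ?pnatr_eq0.
Qed.
Lemma mean_conj m r G : (mean m r G)^* = mean m r (fun z => (G z)^* ).
Proof.
rewrite /mean rmorphM fmorphV rmorphXn rmorph_nat; congr (_ / _).
by rewrite rmorph_sum.
Qed.

(** The rectangle with sides [ln r1 - ln r0] and [2 * pi] is mapped by [cexp] onto the annulus,
    which avoids the possible singularity at 0. The two horizontal sums agree by periodicity, and
    each vertical one is [iC R * rc (2 * pi)] times a mean. *)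
Lemma mean_indep G (rho : R) :
  (forall z, z != 0 -> rnorm z < rho -> differentiable G z) ->
  forall r0 r1, 0 < r0 -> r0 < r1 -> r1 < rho ->
  cconverges (fun m => mean m r1 G - mean m r0 G) 0.
Proof.
move=> dG r0 r1 p0 p01 p1 e e0.
pose H := G \o @cexp R.
have l01 : ln r0 < ln r1 by rewrite ltr_ln // posrE // (lt_trans p0).
have pi2 : 0 < 2 * pi :> R by rewrite mulr_gt0 ?pi_gt0.
have Cpi : 2 * pi != 0 :> R by rewrite gt_eqF.
have a0 : 0 < ln r1 - ln r0 by rewrite subr_gt0.
have dH x y : ln r0 <= x <= ln r0 + (ln r1 - ln r0) -> 0 <= y <= 0 + 2 * pi ->
    differentiable H (pt x y).
  move=> /andP[x0 x1] _; apply: differentiable_comp; first exact: differentiable_cexp.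
  apply: dG; first exact: cexp_neq0.
  rewrite rnorm_cexp.
  rewrite reC_pt.
  apply: le_lt_trans p1; rewrite -ler_ln ?posrE ?expR_gt0 ?(lt_trans p0) // expRK; lra.
have [M HM] := goursat a0 pi2 dH (mulr_gt0 e0 pi2).
exists M => m /HM; rewrite /contour.
have e1 (p q s : R) : pt p q + rc s = pt (p + s) q by rewrite /pt rcD; ring.
have per : side m H (pt (ln r0) 0 + iC R * rc (2 * pi)) (rc (ln r1 - ln r0)) =
           side m H (pt (ln r0) 0) (rc (ln r1 - ln r0)).
  rewrite /side; congr (_ * _); apply: eq_bigr => k _; rewrite /H /=; congr G.
  rewrite addrAC [LHS]cexpD.
  have -> : cexp (iC R * rc (2 * pi)) = 1; last by rewrite mulr1.
  rewrite iC_rc /cexp reC_pt imC_pt.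
  have -> : 2 * pi = 0 + pi *+ 2 :> R by rewrite add0r -[RHS]mulr_natl.
  by rewrite cosD2pi sinD2pi cos0 sin0 expR0 /pt rc0 rc1; ring.
have sm r : 0 < r -> side m H (pt (ln r) 0) (iC R * rc (2 * pi)) =
    iC R * rc (2 * pi) * mean m r G.
  move=> rp; rewrite /side /mean [RHS]mulrA [RHS]mulrAC; congr (_ * _).
  apply: eq_bigr => k _; rewrite /H /= cexpD -mulrA -rcM /circ; congr (G (_ * _)).
  rewrite /cexp reC_pt imC_pt.
  by rewrite lnK ?posrE // cos0 sin0 /pt rc0 rc1; ring.
rewrite per e1 (addrC (ln r0)) subrK !sm ?(lt_trans p0 p01) //.
set A := side _ _ _ _; set B := iC R * _.
have -> : A + B * mean m r1 G - A - B * mean m r0 G = B * (mean m r1 G - mean m r0 G - 0).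
  by ring.
by rewrite rnormM rnormM rnorm_iC mul1r rnorm_rc ger0_norm ?(ltW pi2) // mulrC ler_pM2r.
Qed.

Lemma circD s t : circ (s + t) = circ s * circ t.
Proof. by rewrite /circ -cexpD; congr cexp; rewrite -mulrDr -rcD -mulrDr. Qed.
Lemma circ0 : circ 0 = 1.
Proof. by rewrite /circ mulr0 rc0 mulr0 cexp0. Qed.
Lemma circ1 : circ 1 = 1.
Proof.
rewrite /circ mulr1 iC_rc /cexp reC_pt imC_pt.
have -> : 2 * pi = 0 + pi *+ 2 :> R by rewrite add0r -[RHS]mulr_natl.
by rewrite cosD2pi sinD2pi cos0 sin0 expR0 /pt rc0 rc1; ring.
Qed.
Lemma circX t k : circ (k%:R * t) = circ t ^+ k.
Proof.
elim: k => [|k IH]; first by rewrite mul0r circ0.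
by rewrite -natr1 mulrDl mul1r circD IH exprSr.
Qed.
Lemma circ_nat k : circ k%:R = 1.
Proof. by rewrite -(mulr1 k%:R) circX circ1 expr1n. Qed.
Lemma circ_neq1 t : 0 < t < 2^-1 -> circ t != 1.
Proof.
move=> /andP[t0 t1]; apply/eqP => /(congr1 (@imC R)).
rewrite /circ iC_rc /cexp reC_pt imC_pt expR0 rc1 mul1r imC_pt.
have pi0 : 0 < pi :> R := pi_gt0 R.
apply/eqP; rewrite gt_eqF // [X in X < _](_ : _ = 0) //; apply: sin_gt0_pi.
have t2 : 2 * t < 1 by lra.
have -> : 2 * pi * t = 2 * t * pi by rewrite mulrAC.
by rewrite ?in_itv /= mulr_gt0 ?mulr_gt0 //= gtr_pMl.
Qed.

(** A full geometric sum of a root of unity [q] other than 1 vanishes. The bound on [j] keeps the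
    angle below half a turn, where the sine is positive and [circ_neq1] applies. *)
Lemma mean_expV m r j : 0 < r -> (0 < j)%N -> (j.*2 < 2 ^ m)%N ->
  mean m r (fun z => z ^- j) = 0.
Proof.
move=> r0 j0 jm; have p : (0 : R) < 2 ^+ m by rewrite exprn_gt0.
pose q := (circ (j%:R / 2 ^+ m))^-1.
rewrite /mean (eq_bigr (fun k : 'I__ => (rc r ^- j) * q ^+ k)); last first.
  move=> k _; rewrite exprMn invfM; congr (_ * _).
  rewrite /q exprVn -!circX; congr (_^-1); congr circ; first by rewrite mulrCA.
rewrite -mulr_sumr.
suff -> : \sum_(k < 2 ^ m) q ^+ k = 0 by rewrite mulr0 mul0r.
have q1 : q - 1 != 0.
  rewrite subr_eq0 /q invr_eq1; apply: circ_neq1.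
  rewrite divr_gt0 ?ltr0n //= ltr_pdivrMr // mulrC -ltr_pdivrMr ?invr_gt0 // invrK.
  by rewrite -natrM muln2 -natrX ltr_nat.
apply: (mulfI q1); rewrite mulr0 -subrX1 /q exprVn -circX natrX mulrCA divff ?gt_eqF //.
by rewrite mulr1 circ_nat invr1 subrr.
Qed.

(* The limit of the averages does not depend on the radius, so it can be read
   off on small circles, where the negative powers average to zero. *)
Lemma mean_cvg G (rho : R) l c1 c2 :
  (forall z, z != 0 -> rnorm z < rho -> differentiable G z) ->
  (forall e : R, 0 < e -> exists2 d : R, 0 < d & forall z, z != 0 -> rnorm z < d ->
     rnorm (G z - (l + c1 / z + c2 / z ^+ 2)) <= e) ->
  forall r, 0 < r -> r < rho -> cconverges (fun m => mean m r G) l.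
Proof.
move=> dG HG r r0 r1 e e0.
have e2 : 0 < e / 2 by rewrite divr_gt0.
have [d d0 Hd] := HG _ e2.
pose s := Num.min (r / 2) (d / 2).
have s0 : 0 < s by rewrite lt_min !divr_gt0.
have sr : s < r by rewrite gt_min; apply/orP; left; lra.
have sd : s < d by rewrite gt_min; apply/orP; right; lra.
clearbody s.
have [M HM] := mean_indep dG s0 sr r1 e2.
(* From level 3 on there are at least 8 nodes, more than the 4 that the pole of order 2 must stay
   below in [mean_expV]. *)
exists (maxn M 3) => m; rewrite geq_max => /andP[/HM Hm m3].
have -> : mean m r G - l = (mean m r G - mean m s G - 0) +
   mean m s (fun z => G z - (l + c1 / z + c2 / z ^+ 2)).
  rewrite meanB !meanD !meanZ mean_cst.
  have m8 : (8 <= 2 ^ m)%N by rewrite -[8%N]/(2 ^ 3)%N leq_pexp2l.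
  have := @mean_expV m s 1 s0 isT (leq_trans _ m8) => /(_ isT).
  have := @mean_expV m s 2 s0 isT (leq_trans _ m8) => /(_ isT).
  by rewrite (_ : (fun z : C R => z ^- 1) = GRing.inv) // => -> ->; ring.
apply: le_trans (rnormD _ _) _; rewrite [leRHS]splitr; apply: lerD => //.
apply: mean_bound; first exact: ltW.
by move=> z zs; apply: Hd; rewrite ?zs // -rnorm_gt0 zs.
Qed.
End Averages.

(** * Cauchy estimates and regularity *)

Section Regularity.
Variable R : realType.
Implicit Types (V W : normedModType (C R)) (m : nat) (r t : R).

Lemma has_diff_eps_linear V W (f : V -> W) x (L : V -> W) k : linear L ->
  (forall h, rnorm (L h) <= k * rnorm h) -> has_diff_eps f x L ->
  differentiable f x /\ 'd f x = L :> (V -> W).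
Proof.
move=> linL bL.
pose L' : {linear V -> W} := HB.pack L (GRing.isLinear.Build _ _ _ _ L linL).
exact: (@has_diff_eps_diff _ _ _ f x L').
Qed.

Lemma near_has_diff_eps V W (f g : V -> W) x (L : V -> W) (d : R) : 0 < d ->
  (forall y, rnorm (y - x) < d -> f y = g y) -> has_diff_eps f x L -> has_diff_eps g x L.
Proof.
move=> d0 fg H e e0; have [d' d0' Hd] := H e e0.
exists (Num.min d d'); first by rewrite lt_min d0 d0'.
move=> h; rewrite lt_min => /andP[hd /Hd].
by rewrite !fg // ?subrr ?rnorm0 // addrC addKr.
Qed.

Lemma diff_bound V W (f : V -> W) x : differentiable f x ->
  exists2 k : R, 0 <= k & forall h, rnorm ('d f x h) <= k * rnorm h.
Proof.
move=> df; have [k /gt0_rc[-> k0] H] := linear_lipschitz (diff_continuous df).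
by exists (reC k); [exact: ltW|move=> h; have := H h; rewrite !norm_rnorm -rcM le_rc].
Qed.

Lemma near_diff V W (f g : V -> W) x (d : R) : 0 < d ->
  (forall y, rnorm (y - x) < d -> f y = g y) -> differentiable f x ->
  differentiable g x /\ 'd g x = 'd f x :> (V -> W).
Proof.
move=> d0 fg df; have [k _ Hk] := diff_bound df.
apply: (@has_diff_eps_diff _ _ _ _ _ ('d f x) k) => //.
exact: near_has_diff_eps d0 fg (diff_has_diff_eps df).
Qed.

(** Complex values admit no mean value equality, so the segment is bisected: if [f] grows faster
    than [L + e] on it, it does so on one half, and the common point contradicts the bound on the
    differential. *)
Lemma mean_value_ineq V (f : V -> C R) (w u : V) (L : R) :
  (forall t, 0 <= t <= 1 -> differentiable f (w + rc t *: u) /\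
     rnorm ('d f (w + rc t *: u) u) <= L) ->
  rnorm (f (w + u) - f w) <= L.
Proof.
move=> H; apply/ler_addgt0Pr => e e0; rewrite leNgt; apply/negP => HL.
pose g t := f (w + rc t *: u).
pose P (x y a b : R) := (L + e) * a < rnorm (g (x + a) - g x).
have P0 : P 0 0 1 0 by rewrite /P mulr1 add0r /g rc1 scale1r rc0 scale0r addr0.
have step x y a b : P x y a b ->
    exists x' y', [/\ P x' y' (a / 2) (b / 2), x' = x \/ x' = x + a / 2 &
                      y' = y \/ y' = y + b / 2].
  rewrite /P => Pq.
  have [h1|h1] := ltP ((L + e) * (a / 2)) (rnorm (g (x + a / 2) - g x)).
    by exists x, y; split=> //; left.
  have [h2|h2] := ltP ((L + e) * (a / 2)) (rnorm (g (x + a / 2 + a / 2) - g (x + a / 2))).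
    by exists (x + a / 2), y; split=> //; [right|left].
  move: Pq; rewrite ltNge => /negP[].
  have -> : g (x + a) - g x = (g (x + a / 2 + a / 2) - g (x + a / 2)) + (g (x + a / 2) - g x).
    by rewrite addrA subrK -[x + _ + _]addrA -splitr.
  apply: le_trans (rnormD _ _) _; lra.
have [s [t0 st]] := nested_rectangles ler01 (lexx 0) P0 step.
have [x0 [y0 [_ [? ? ? ?] _]]] := st 0%N.
have [|ds bs] := H s; first by lra.
have u1 : 0 < rnorm u + 1 by rewrite ltr_wpDl ?rnorm_ge0.
have [d d0 Hd] := diff_has_diff_eps ds (divr_gt0 e0 u1).
have [k Hk] := div_expr2_small ler01 (divr_gt0 d0 u1).
have := st k; set a := 1 / 2 ^+ k; move=> [x [y [Pk [x1 x2 x3 x4] _]]].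
have a0 : 0 <= a by rewrite divr_ge0 // exprn_ge0.
have ad : a * rnorm u < d.
  apply: le_lt_trans (_ : _ <= a * (rnorm u + 1)) _; last by rewrite -ltr_pdivlMr.
  by rewrite ler_wpM2l // lerDl.
pose D := 'd f (w + rc s *: u) u.
have rem q : `|q - s| <= a ->
    rnorm (g q - g s - rc (q - s) * D) <= e * `|q - s|.
  move=> qs; have := Hd (rc (q - s) *: u); rewrite rnormZ rnorm_rc.
  have lt1 : `|q - s| * rnorm u < d by apply: le_lt_trans ad; rewrite ler_wpM2r ?rnorm_ge0.
  move=> /(_ lt1); rewrite linearZ /= -(addrA w) -scalerDl -rcD (addrC s) subrK.
  move=> HH; apply: le_trans HH _.
  rewrite mulrCA mulrC ler_wpM2r // -mulrA ler_piMr ?(ltW e0) //.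
  by rewrite mulrC ler_pdivrMr // mul1r lerDl.
move: Pk; rewrite /P ltNge => /negP[].
have b1 : `|x + a - s| <= a by rewrite ler_norml; lra.
have b2 : `|x - s| <= a by rewrite ler_norml; lra.
have r1 := rem _ b1; have r2 := rem _ b2.
(* As [s] lies between [x] and [x + a], the two remainders are at most [e * (x + a - s)] and
   [e * (s - x)], in total [e * a]. *)
have -> : g (x + a) - g x = (g (x + a) - g s - rc (x + a - s) * D)
   - (g x - g s - rc (x - s) * D) + rc a * D.
  by rewrite !rcB rcD; ring.
apply: le_trans (rnormD _ _) _; apply: le_trans (lerD (rnormB _ _) (lexx _)) _.
apply: le_trans (lerD (lerD r1 r2) (lexx _)) _.
have n1 : `|x + a - s| = x + a - s by rewrite ger0_norm //; lra.
have n2 : `|x - s| = s - x by rewrite ler0_norm ?opprB //; lra.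
rewrite rnormM rnorm_rc (ger0_norm a0) n1 n2.
have : a * rnorm D <= a * L by rewrite ler_wpM2l.
lra.
Qed.

Definition on_ball V (a : V) (rho : R) (P : V -> Prop) := forall w, rnorm (w - a) < rho -> P w.

(** Dividing by [s] moves the derivative to the constant term and leaves a simple pole with residue
    [f z], which [mean_cvg] discards. *)
Lemma cauchy_derivative V (f : V -> C R) z v (rho : R) :
  (forall s : C R, rnorm s < rho -> differentiable f (z + s *: v)) ->
  forall r, 0 < r -> r < rho ->
  cconverges (fun m => mean m r (fun s => f (z + s *: v) / s)) ('d f z v).
Proof.
move=> df; have rho0 r : 0 < r -> r < rho -> 0 < rho by exact: lt_trans.
have dl s : differentiable (fun s : C R => z + s *: v) s.
  apply: differentiableD => //.
move=> r r0 r1; apply: (@mean_cvg _ _ rho _ (f z) 0) => //.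
  move=> s s0 sr; apply: differentiableM.
    exact: (@differentiable_comp _ _ _ _ (fun s : C R => z + s *: v) f _ (dl s) (df s sr)).
  exact: differentiableV.
have dz : differentiable f z.
  by rewrite -(addr0 z) -(scale0r v); apply: df; rewrite rnorm0 (rho0 r).
move=> e e0; have v1 : 0 < rnorm v + 1 by rewrite ltr_wpDl ?rnorm_ge0.
have [d d0 Hd] := diff_has_diff_eps dz (divr_gt0 e0 v1).
exists (d / (rnorm v + 1)); first exact: divr_gt0.
move=> s s0 sd; have sv : rnorm (s *: v) < d.
  rewrite rnormZ; apply: le_lt_trans (_ : _ <= rnorm s * (rnorm v + 1)) _.
    by rewrite ler_wpM2l ?rnorm_ge0 // lerDl.
  by rewrite -ltr_pdivlMr.
have := Hd _ sv; rewrite linearZ /= => HH.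
have -> : f (z + s *: v) / s - ('d f z v + f z / s + 0 / s ^+ 2) =
   (f (z + s *: v) - f z - s * 'd f z v) / s by field.
rewrite rnormM rnormV ler_pdivrMr ?rnorm_gt0 //; apply: le_trans HH _.
rewrite rnormZ mulrCA mulrC ler_wpM2r ?rnorm_ge0 // -mulrA ler_piMr ?(ltW e0) //.
by rewrite mulrC ler_pdivrMr // mul1r lerDl.
Qed.

(** The factor 2 comes from the circle of half the admissible radius [d / rnorm v], since the circle
    must lie strictly inside. *)
Lemma cauchy_estimate V (f : V -> C R) (w : V) (d M : R) : 0 < d -> 0 <= M ->
  on_ball w d (fun y => differentiable f y /\ rnorm (f y) <= M) ->
  forall v, rnorm ('d f w v) <= 2 * M / d * rnorm v.
Proof.
move=> d0 M0 H v.
have [->|v0] := eqVneq v 0; first by rewrite linear0 !rnorm0 mulr0.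
have nv : 0 < rnorm v by rewrite rnorm_gt0.
have ball (s : C R) : rnorm s < d / rnorm v -> rnorm (w + s *: v - w) < d.
  by move=> sr; rewrite addrC addKr rnormZ -ltr_pdivlMr.
have r0 : 0 < d / rnorm v / 2 by rewrite !divr_gt0.
have r1 : d / rnorm v / 2 < d / rnorm v by rewrite ltr_pdivrMr // ltr_pMr ?divr_gt0 // ltr1n.
have cv := @cauchy_derivative V f w v _ (fun s sr => (H _ (ball s sr)).1) _ r0 r1.
apply: (@ccvg_le _ _ _ _ 0%N cv) => m _; apply: mean_bound; first exact: ltW.
move=> s sr; rewrite rnormM rnormV sr ler_pdivrMr //.
have -> : 2 * M / d * rnorm v * (d / rnorm v / 2) = M by field; rewrite !gt_eqF.
by apply: (H _ _).2; apply: ball; rewrite sr.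
Qed.

Lemma diff_shift V W (f : V -> W) (x c : V) : differentiable f (x + c) ->
  differentiable (fun y => f (y + c)) x /\ 'd (fun y => f (y + c)) x = 'd f (x + c) :> (V -> W).
Proof.
move=> df; have [k _ Hk] := diff_bound df.
apply: (@has_diff_eps_diff _ _ _ _ _ ('d f (x + c)) k) => // e e0.
have [d d0 Hd] := diff_has_diff_eps df e0; exists d => // h /Hd.
by rewrite (addrAC x c).
Qed.

Lemma diff_sub V W (f g : V -> W) x : differentiable f x -> differentiable g x ->
  differentiable (fun y => f y - g y) x /\
  forall v, 'd (fun y => f y - g y) x v = 'd f x v - 'd g x v.
Proof.
have linB (A B : {linear V -> W}) : linear (fun v => A v - B v).
  move=> c u v; rewrite (linearD A) (linearD B) !linearZ_LR scalerBr.
  by rewrite (opprD (c *: B u)) addrACA.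
move=> df dg; have [k k0 Hk] := diff_bound df; have [k' k0' Hk'] := diff_bound dg.
have {df} df := diff_has_diff_eps df; have {dg} dg := diff_has_diff_eps dg.
move: ('d f x) ('d g x) Hk Hk' df dg => A B Hk Hk' df dg.
have [] := @has_diff_eps_linear _ _ (fun y => f y - g y) x (fun v => A v - B v) (k + k').
- exact: linB.
- by move=> h; apply: le_trans (rnormB _ _) _; rewrite mulrDl lerD.
- move=> e e0; have e2 : 0 < e / 2 by rewrite divr_gt0.
  have [d d0 Hd] := df _ e2; have [d' d0' Hd'] := dg _ e2.
  exists (Num.min d d'); first by rewrite lt_min d0.
  move=> h; rewrite lt_min => /andP[/Hd hd /Hd' hd'].
  have -> : f (x + h) - g (x + h) - (f x - g x) - (A h - B h) =
     (f (x + h) - f x - A h) - (g (x + h) - g x - B h).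
    have H (p q r s : W) : p - q - (r - s) = (p - r) - (q - s).
      by rewrite opprB [s - r]addrC addrACA [- q + s]addrC [in RHS]opprB.
    by rewrite (H (f (x + h)) (g (x + h))) (H (f (x + h) - f x)).

  by apply: le_trans (rnormB _ _) (le_trans (lerD hd hd') _); lra.
by move=> dB eB; split=> // v; rewrite eB.
Qed.

(** Cauchy estimates and the mean value inequality alternate: [f] is bounded, hence ['d f] is
    bounded, hence [f] is Lipschitz, hence its translation differences are small and so are the
    differences of ['d f]. The last claim is the mean value inequality for [f] minus its linear part
    at [w]. *)
Lemma derivative_locally_lipschitz V (f : V -> C R) a (rho : R) : 0 < rho -> on_ball a rho (fun y => differentiable f y) ->
  exists d K : R, [/\ 0 < d, d <= rho, 0 <= K,
    forall w w' v, rnorm (w - a) < d -> rnorm (w' - a) < d ->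
      rnorm ('d f w v - 'd f w' v) <= K * rnorm (w - w') * rnorm v &
    forall w h, rnorm (w - a) < d -> rnorm (w + h - a) < d ->
      rnorm (f (w + h) - f w - 'd f w h) <= K * rnorm h ^+ 2].
Proof.
move=> rho0 df.
have da : differentiable f a by apply: df; rewrite subrr rnorm0.
have /cvg_rnorm/(_ 1 ltr01)[d1 d10 Hd1] := differentiable_continuous da.
(* Concentric balls: values are bounded within [d * 4], the first Cauchy estimate holds within
   [d * 3], and the second, around points within [d], stays within [d * 2]. *)
have [d [d0 drho dd1]] : exists d : R, [/\ 0 < d, d * 4 <= rho & d * 4 <= d1].
  exists (Num.min rho d1 / 4); rewrite divr_gt0 ?lt_min ?rho0 ?d10 //.
  by rewrite divfK ?pnatr_eq0 // !ge_min !lexx orbT.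
pose M := rnorm (f a) + 1.
have M0 : 0 <= M by rewrite addr_ge0 ?rnorm_ge0.
have bM w : rnorm (w - a) < d * 4 -> rnorm (f w) <= M.
  move=> wd; have -> : f w = (f w - f a) + f a by ring.
  apply: le_trans (rnormD _ _) _; rewrite addrC lerD2l.
  by have := Hd1 (w - a); rewrite (addrC a) subrK; apply; apply: lt_le_trans dd1.
have tri w u (p q : R) : rnorm (w - a) < p -> rnorm (u - w) < q -> rnorm (u - a) < p + q.
  move=> wp uq; have -> : u - a = (w - a) + (u - w) by rewrite [RHS]addrC addrA subrK.
  by apply: le_lt_trans (rnormD _ _) _; apply: ltrD.
have cvx w u t (p : R) : rnorm (w - a) < p -> rnorm (w + u - a) < p -> 0 <= t <= 1 ->
    rnorm (w + rc t *: u - a) < p.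
  move=> wp up /andP[t0 t1].
  have -> : w + rc t *: u - a = rc (1 - t) *: (w - a) + rc t *: (w + u - a).
    have ac (q : V) : w + q - a = w - a + q by rewrite addrAC.
    rewrite !ac; move: (w - a) => p'.
    by rewrite rcB scalerBl rc1 scale1r scalerDr addrA subrK.
  apply: le_lt_trans (rnormD _ _) _; rewrite !rnormZ !rnorm_rc !ger0_norm ?subr_ge0 //.
  have [->|tn0] := eqVneq t 0; first by rewrite subr0 mul1r mul0r addr0.
  have tp : 0 < t by rewrite lt_def tn0.
  have : (1 - t) * rnorm (w - a) <= (1 - t) * p by rewrite ler_wpM2l ?subr_ge0 // ltW.
  have : t * rnorm (w + u - a) < t * p by rewrite ltr_pM2l.
  lra.
pose L := 2 * M / d.
have L0 : 0 <= L by rewrite divr_ge0 ?mulr_ge0 ?(ltW d0).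
have b1 w : rnorm (w - a) < d * 3 -> forall v, rnorm ('d f w v) <= L * rnorm v.
  move=> wd; apply: cauchy_estimate => // y yw.
  have y4 : rnorm (y - a) < d * 4.
    by rewrite (_ : d * 4 = d * 3 + d); [exact: tri wd yw|ring].
  by split; [apply: df; exact: lt_le_trans drho|exact: bM].
have b2 w u : rnorm (w - a) < d * 3 -> rnorm (w + u - a) < d * 3 ->
    rnorm (f (w + u) - f w) <= L * rnorm u.
  move=> wd ud; apply: mean_value_ineq => t t01; have wt := cvx _ _ _ _ wd ud t01.
  split; last exact: b1.
  by apply: df; apply: lt_le_trans drho; apply: lt_trans wt _; rewrite ltr_pM2l // ltr_nat.
pose K := 2 * L / d.
have K0 : 0 <= K by apply: divr_ge0; [apply: mulr_ge0|exact: ltW].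
have lt_d w (k : nat) : (k < 5)%N -> rnorm (w - a) < d * k%:R -> differentiable f w.
  move=> k5 wd; apply: df; apply: lt_le_trans drho; apply: lt_le_trans wd _.
  by rewrite ler_pM2l // ler_nat.
(* The Cauchy estimate is applied to [f (y + c) - f y], whose size is at most [L * rnorm c] by
   [b2]. *)
have b3 w w' v : rnorm (w - a) < d -> rnorm (w' - a) < d ->
    rnorm ('d f w v - 'd f w' v) <= K * rnorm (w - w') * rnorm v.
  move=> wd wd'; pose c := w - w'.
  have wc : w' + c = w by rewrite /c addrC subrK.
  have inb y : rnorm (y - w') < d -> rnorm (y - a) < d * 2 /\ rnorm (y + c - a) < d * 2.
    move=> yw; split; rewrite mulr_natr mulr2n; first exact: tri wd' yw.
    by apply: tri wd _; rewrite /c addrA addrAC addrK.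
  have [g gE dg] : exists2 g, g = (fun y => f (y + c) - f y) & forall y, rnorm (y - w') < d ->
      differentiable g y /\ 'd g y v = 'd f (y + c) v - 'd f y v.
    eexists; first by []; move=> y /inb[y1 y2].
    have df1 := lt_d _ 2%N isT y1; have [df2 e2] := diff_shift (lt_d _ 2%N isT y2).
    have [dB eB] := diff_sub df2 df1; split; first exact: dB.
    exact: (etrans (eB v) (congr1 (fun A : V -> C R => A v - 'd f y v) e2)).
  have ww : rnorm (w' - w') < d by rewrite subrr rnorm0.
  have [_ ] := dg w' ww; rewrite wc => <-.
  have -> : K * rnorm (w - w') * rnorm v = 2 * (L * rnorm c) / d * rnorm v.
    by rewrite /K; ring.
  apply: cauchy_estimate => //; first by rewrite mulr_ge0 ?rnorm_ge0.
  move=> y yw; split; first exact: (dg y yw).1.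
  have [y1 y2] := inb y yw; rewrite gE.
  by apply: b2; apply: lt_trans (_ : d * 2 < d * 3) => //; rewrite ltr_pM2l // ltr_nat.
exists d, K; split=> //.
  by apply: le_trans drho; rewrite ler_peMr ?(ltW d0) // ler1n.
move=> w h wd hd.
have dw : differentiable f w by apply: (lt_d w 1%N) => //; rewrite mulr1.
have dL y : differentiable (fun y => 'd f w (y - w)) y /\
    'd (fun y => 'd f w (y - w)) y = 'd f w :> (V -> C R).
  have [k _ Hk] := diff_bound dw.
  apply: (@has_diff_eps_diff _ _ _ _ _ ('d f w) k) => // e e0; exists 1 => // u _.
  have -> : 'd f w (y + u - w) - 'd f w (y - w) - 'd f w u = 0.
    move: ('d f w) => A; rewrite (addrAC y) (linearD A (y - w)) /=; ring.
  by rewrite rnorm0 mulr_ge0 ?rnorm_ge0 // ltW.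
have [g gE dg] : exists2 g, g = (fun y => f y - 'd f w (y - w)) &
    forall y, differentiable f y -> differentiable g y /\ 'd g y h = 'd f y h - 'd f w h.
  eexists; first by []; move=> y dy.
  have [dB eB] := diff_sub dy (dL y).1; split; first exact: dB.
  exact: (etrans (eB h) (congr1 (fun A : V -> C R => 'd f y h - A h) (dL y).2)).
have -> : f (w + h) - f w - 'd f w h = g (w + h) - g w.
  by rewrite gE; move: ('d f w) => A; rewrite subrr linear0 subr0 (addrC w) addrK; ring.
apply: mean_value_ineq => t t01; have wt := cvx _ _ _ _ wd hd t01.
have dt : differentiable f (w + rc t *: h) by apply: (lt_d _ 1%N) => //; rewrite mulr1.
have [dgt ->] := dg _ dt; split; first exact: dgt.
apply: le_trans (b3 _ _ _ wt wd) _.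
rewrite addrAC subrr add0r rnormZ rnorm_rc expr2 [leRHS]mulrA ler_wpM2r ?rnorm_ge0 //.
rewrite ler_wpM2l // ler_piMl ?rnorm_ge0 //.
by case/andP: t01 => t0 t1; rewrite ger0_norm.
Qed.
End Regularity.

(** * Differentiability of the derivative, and reduction to coordinates and lines *)

Section Smooth.
Variable R : realType.
Implicit Types (V W : normedModType (C R)) (m : nat) (r t : R).

Lemma ccauchy_cvg (u : nat -> C R) :
  (forall e : R, 0 < e -> exists M, forall m m', (M <= m)%N -> (M <= m')%N ->
     rnorm (u m - u m') <= e) -> exists l, cconverges u l.
Proof.
move=> H.
have rl (p : C R -> R) : (forall z w, p (z - w) = p z - p w) -> (forall z, `|p z| <= rnorm z) ->
    exists l : R, forall e : R, 0 < e -> exists M, forall m, (M <= m)%N -> `|p (u m) - l| <= e.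
  move=> pB pn.
  have cv : cvg ((p \o u) @ \oo).
    apply/cauchy_cvgP/cauchy_exP => e e0.
    have e2 : 0 < e / 2 by rewrite divr_gt0.
    have [M HM] := H (e / 2) e2.
    exists (p (u M)); exists M => // m /= Mm; rewrite -ball_normE /= -pB.
    apply: le_lt_trans (pn _) (le_lt_trans (HM _ _ _ _) _) => //.
    by rewrite ltr_pdivrMr // ltr_pMr // ltr1n.
  exists (lim ((p \o u) @ \oo)) => e e0.
  have [M _ HM] := (cvgrPdist_le _ _).1 cv e e0.
  by exists M => m Mm; rewrite distrC; apply: HM.
have [a Ha] := rl (@reC R) (@reCB R) (@reC_le R).
have [b Hb] : exists l : R, forall e : R, 0 < e -> exists M, forall m, (M <= m)%N -> `|imC (u m) - l| <= e.
  by apply: rl; [case=> ? ? []|exact: imC_le].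
exists (pt a b) => e e0; have e2 : 0 < e / 2 by rewrite divr_gt0.
have [M HM] := Ha _ e2; have [M' HM'] := Hb _ e2.
exists (maxn M M') => m; rewrite geq_max => /andP[/HM h1 /HM' h2].
have -> : u m - pt a b = pt (reC (u m) - a) (imC (u m) - b).
  by rewrite {1}[u m]C_split /pt !rcB; ring.
by apply: le_trans (rnorm_pt _ _) _; rewrite [leRHS]splitr lerD.
Qed.

Lemma quadratic_has_diff_eps V W (f : V -> W) x (L : V -> W) (K d : R) : 0 < d ->
  (forall h, rnorm h < d -> rnorm (f (x + h) - f x - L h) <= K * rnorm h ^+ 2) -> has_diff_eps f x L.
Proof.
move=> d0 H e e0; have k0 : 0 < `|K| + 1 by rewrite ltr_wpDl.
exists (Num.min d (e / (`|K| + 1))); first by rewrite lt_min d0 divr_gt0.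
move=> h; rewrite lt_min => /andP[/H hd he]; apply: le_trans hd _.
rewrite expr2 mulrA ler_wpM2r ?rnorm_ge0 //.
move: he; rewrite ltr_pdivlMr // => he; apply: le_trans (ltW he).
rewrite mulrC ler_wpM2l ?rnorm_ge0 //.
by apply: le_trans (ler_norm _) _; rewrite lerDl.
Qed.

(** The Cauchy formula for ['d f (a + h) v] is differentiated under the mean: [F m h] are its
    approximants and [L m h] their formal derivatives. The quadratic error [FL] is uniform in [m],
    so it survives the limit. *)
Lemma diff_derivative V (f : V -> C R) a (rho : R) v : 0 < rho ->
  on_ball a rho (fun y => differentiable f y) -> differentiable (fun z => 'd f z v) a.
Proof.
move=> rho0 df; have [d [K [d0 drho K0 HK1 HK2]]] := derivative_locally_lipschitz rho0 df.
have v1 : 0 < rnorm v + 1 by rewrite ltr_wpDl ?rnorm_ge0.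
pose r' := d / 2 / (rnorm v + 1); pose r := r' / 2.
have r'0 : 0 < r' by rewrite !divr_gt0.
have r0 : 0 < r by rewrite divr_gt0.
have rr' : r < r' by rewrite ltr_pdivrMr // ltr_pMr // ltr1n.
have sv (s : C R) : rnorm s < r' -> rnorm (s *: v) < d / 2.
  rewrite rnormZ ltr_pdivlMr // => sr; apply: le_lt_trans sr.
  by rewrite ler_wpM2l ?rnorm_ge0 // lerDl.
have inb (h : V) (s : C R) : rnorm h < d / 2 -> rnorm s < r' -> rnorm (a + h + s *: v - a) < d.
  move=> hd /sv sd; have -> : a + h + s *: v - a = h + s *: v by rewrite addrAC (addrC a) addrK.
  by apply: le_lt_trans (rnormD _ _) _; rewrite [ltRHS]splitr ltrD.
have d2 : 0 < d / 2 by rewrite divr_gt0.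
have dfw w : rnorm (w - a) < d -> differentiable f w.
  by move=> wd; apply: df; apply: lt_le_trans drho.
pose F m h := mean m r (fun s => f (a + h + s *: v) / s).
pose L m h := mean m r (fun s => 'd f (a + s *: v) h / s).
have inb0 (s : C R) : rnorm s < r' -> rnorm (a + s *: v - a) < d.
  by move=> sr; have := inb 0 s; rewrite addr0 rnorm0; apply.
have FL m h : rnorm h < d / 2 -> rnorm (F m h - F m 0 - L m h) <= K / r * rnorm h ^+ 2.
  move=> hd; rewrite /F /L -!meanB; apply: mean_bound; first exact: ltW.
  move=> s sr; have s1 : rnorm s < r' by rewrite sr.
  have -> : f (a + h + s *: v) / s - f (a + 0 + s *: v) / s - 'd f (a + s *: v) h / s =
     (f (a + s *: v + h) - f (a + s *: v) - 'd f (a + s *: v) h) / s.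
    by rewrite addr0 (addrAC a h) !mulrBl.
  rewrite rnormM rnormV sr mulrAC ler_wpM2r ?invr_ge0 ?(ltW r0) //.
  by apply: HK2; [exact: inb0|rewrite (addrAC a); exact: inb].
have FC h : rnorm h < d / 2 -> cconverges (F ^~ h) ('d f (a + h) v).
  move=> hd; apply: (@cauchy_derivative _ _ f (a + h) v r') => // s sr.
  by apply: dfw; exact: inb.
have LZ m t h : L m (rc t *: h) = rc t * L m h.
  by rewrite /L -meanZ; congr (mean _ _ _); apply/funext => s; rewrite linearZ /= -mulrA.
have LD m g h : L m (g + h) = L m g + L m h.
  by rewrite /L -meanD; congr (mean _ _ _); apply/funext => s; rewrite linearD /= mulrDl.
have LZc m c h : L m (c *: h) = c * L m h.
  by rewrite /L -meanZ; congr (mean _ _ _); apply/funext => s; rewrite linearZ /= -mulrA.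
(* The Cauchy formula cannot be used here: it would ask for holomorphy of the derivative, the very
   claim. Instead linearity replaces [h] by a small multiple [rc t *: h], where [FL] compares [L]
   with differences of the convergent [F], up to [t * (t * B)]. *)
have LC h : exists l, cconverges (L ^~ h) l.
  apply: ccauchy_cvg => e e0.
  pose B := K / r * rnorm h ^+ 2.
  have B0 : 0 <= B by rewrite mulr_ge0 ?exprn_ge0 ?rnorm_ge0 // divr_ge0 // ltW.
  have [t [t0 th tB]] : exists t, [/\ 0 < t, rnorm (rc t *: h) < d / 2 & t * B <= e / 4].
    pose q := Num.min (d / 2 / (rnorm h + 1)) (e / 4 / (B + 1)).
    have h1 : 0 < rnorm h + 1 by rewrite ltr_wpDl ?rnorm_ge0.
    have B1 : 0 < B + 1 by rewrite ltr_wpDl.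
    have q0 : 0 < q by rewrite lt_min !divr_gt0.
    have q1 : q * (rnorm h + 1) <= d / 2 by rewrite -ler_pdivlMr // ge_min lexx.
    have q2 : q * (B + 1) <= e / 4 by rewrite -ler_pdivlMr // ge_min lexx orbT.
    exists q; split=> //; last by apply: le_trans q2; rewrite ler_wpM2l ?lerDl // ltW.
    rewrite rnormZ rnorm_rc ger0_norm ?(ltW q0) //; apply: lt_le_trans q1.
    by rewrite ltr_pM2l // ltrDl.
  (* After multiplication by [t] the allowance is [t * e]: two errors of [t * (e / 4)] from [FL] and
     four of [t * e / 8] from the convergence of [F]. *)
  have te : 0 < t * e / 8 by rewrite divr_gt0 // mulr_gt0.
  have [M1 H1] := FC _ th _ te.
  have z0 : rnorm (0 : V) < d / 2 by rewrite rnorm0.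
  have [M2 H2] := FC _ z0 _ te.
  exists (maxn M1 M2) => m m'; rewrite !geq_max => /andP[p1 p2] /andP[q1 q2].
  have tn : rnorm (rc t) = t by rewrite rnorm_rc gtr0_norm.
  rewrite -(ler_pM2l t0) -{1}tn -rnormM mulrBr -!LZ.
  have E m0 : rnorm (F m0 (rc t *: h) - F m0 0 - L m0 (rc t *: h)) <= t * (t * B).
    apply: le_trans (FL _ _ th) _; rewrite rnormZ tn exprMn /B.
    by rewrite le_eqVlt; apply/orP; left; apply/eqP; ring.
  have tB' : t * (t * B) <= t * (e / 4) by rewrite ler_wpM2l // ltW.
  set x := 'd f (a + rc t *: h) v in H1; set y := 'd f (a + 0) v in H2.
  have -> : L m (rc t *: h) - L m' (rc t *: h) =
     (F m' (rc t *: h) - F m' 0 - L m' (rc t *: h)) - (F m (rc t *: h) - F m 0 - L m (rc t *: h))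
     + ((F m (rc t *: h) - x) - (F m' (rc t *: h) - x))
     - ((F m 0 - y) - (F m' 0 - y)) by ring.
  apply: le_trans (rnormB _ _) _; apply: le_trans (lerD (rnormD _ _) (rnormB _ _)) _.
  apply: le_trans (lerD (lerD (rnormB _ _) (rnormB _ _)) (lexx _)) _.
  have := E m; have := E m'; have := H1 _ p1; have := H1 _ q1; have := H2 _ p2; have := H2 _ q2.
  lra.
have [D HD] := choice LC.
have linD : linear D.
  move=> c g h; apply: ccvg_unique (HD _) _.
  have -> : (fun m => L m (c *: g + h)) = (fun m => c * L m g + L m h).
    by apply/funext => m; rewrite LD LZc.
  by apply: ccvgD; [exact: ccvgZ|].
have da : differentiable f a by apply: dfw; rewrite subrr rnorm0.
have [k k0 Hk] := diff_bound da.
have bD h : rnorm (D h) <= (k + K * d) / r * rnorm h.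
  apply: (@ccvg_le _ _ _ _ 0%N (HD h)) => m _; apply: mean_bound; first exact: ltW.
  move=> s sr; rewrite rnormM rnormV sr mulrAC ler_wpM2r ?invr_ge0 ?(ltW r0) //.
  have sd : rnorm (a + s *: v - a) < d by apply: inb0; rewrite sr.
  have -> : 'd f (a + s *: v) h = 'd f a h + ('d f (a + s *: v) h - 'd f a h) by ring.
  apply: le_trans (rnormD _ _) _; rewrite mulrDl; apply: lerD => //.
  have ad : rnorm (a - a) < d by rewrite subrr rnorm0.
  apply: le_trans (HK1 _ _ h sd ad) _; rewrite ler_wpM2r ?rnorm_ge0 // ler_wpM2l //.
  exact: ltW.
have [] // := @has_diff_eps_linear _ _ _ (fun z => 'd f z v) a D _ linD bD.
apply: (quadratic_has_diff_eps d2 (K := K / r)) => h hd.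
have z0 : rnorm (0 : V) < d / 2 by rewrite rnorm0.
have F0 := FC 0 z0; rewrite addr0 in F0.
(* Differences are written with factors -1 so that [ccvgD] and [ccvgZ] suffice to pass [FL] to the
   limit. *)
have cv : cconverges (fun m => F m h + (- 1) * F m 0 + (- 1) * L m h) ('d f (a + h) v + (- 1) * 'd f a v + (- 1) * D h).
  by apply: ccvgD; [apply: ccvgD; [exact: FC|apply: ccvgZ; exact: F0]|exact: ccvgZ].
have -> : 'd f (a + h) v - 'd f a v - D h = 'd f (a + h) v + (- 1) * 'd f a v + (- 1) * D h.
  by move: ('d f (a + h) v) ('d f a v) => p q; ring.
apply: (@ccvg_le _ _ _ _ 0%N cv) => m _.
by have -> : F m h + (- 1) * F m 0 + (- 1) * L m h = F m h - F m 0 - L m h; [ring|exact: FL].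
Qed.

Lemma diff_coord V n (f : V -> 'rV[C R]_n) x k : differentiable f x ->
  differentiable (fun z => f z 0 k) x /\
  'd (fun z => f z 0 k) x = (fun v => 'd f x v 0 k) :> (V -> C R).
Proof.
move=> df; have [K K0 HK] := diff_bound df.
apply: (@has_diff_eps_linear _ _ _ _ _ _ K).
- by move=> c u v; rewrite linearD linearZ_LR !mxE.
- by move=> h; apply: le_trans (rnorm_coord _ _) _.
move=> e e0; have [d d0 Hd] := diff_has_diff_eps df e0; exists d => // h /Hd.
apply: le_trans; have := rnorm_coord (f (x + h) - f x - 'd f x h) k.
by rewrite !mxE.
Qed.

Lemma finite_near V n (P : 'I_n -> V -> Prop) :
  (forall i, exists2 d : R, 0 < d & forall h, rnorm h < d -> P i h) ->
  exists2 d : R, 0 < d & forall h, rnorm h < d -> forall i, P i h.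
Proof.
move=> H; have /choice[d Hd] : forall k, exists d : R, 0 < d /\ forall h, rnorm h < d -> P k h.
  by move=> k; have [d d0 Hd] := H k; exists d.
exists (\big[Num.min/1]_k d k).
  by elim/big_ind: _ => // [p q p0 q0|k _]; [rewrite lt_min p0|exact: (Hd k).1].
move=> h hd k; apply: (Hd k).2; apply: lt_le_trans hd _; exact: bigmin_le.
Qed.

Lemma differentiable_rV V n (f : V -> 'rV[C R]_n) x :
  (forall k, differentiable (fun z => f z 0 k) x) -> differentiable f x.
Proof.
move=> df; pose L h := \row_k 'd (fun z => f z 0 k) x h.
have [K HK] := choice (fun k => let: ex_intro2 K K0 H := diff_bound (df k) in
  ex_intro (fun K : R => 0 <= K /\ forall h, rnorm ('d (fun z => f z 0 k) x h) <= K * rnorm h) K (conj K0 H)).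
have [] // := @has_diff_eps_linear _ _ _ f x L (\sum_k K k).
- by move=> c u v; apply/rowP => k; rewrite !mxE linearD linearZ_LR.
- move=> h; apply: rnorm_rV_le.
    by rewrite mulr_ge0 ?rnorm_ge0 // sumr_ge0 // => k _; exact: (HK k).1.
  move=> k; rewrite mxE; apply: le_trans ((HK k).2 h) _; rewrite ler_wpM2r ?rnorm_ge0 //.
  by rewrite (bigD1 k) //= lerDl sumr_ge0 // => j _; exact: (HK j).1.
move=> e e0; have [d d0 Hd] := finite_near (fun k => diff_has_diff_eps (df k) e0).
exists d => // h hd; apply: rnorm_rV_le; first by rewrite mulr_ge0 ?rnorm_ge0 // ltW.
by move=> k; rewrite !mxE; exact: (Hd h hd k).
Qed.

Lemma diff_derivative_rV V n (f : V -> 'rV[C R]_n) a (rho : R) v : 0 < rho ->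
  on_ball a rho (fun y => differentiable f y) -> differentiable (fun z => 'd f z v) a.
Proof.
move=> rho0 df; apply: differentiable_rV => k.
have D := @diff_derivative _ (fun z => f z 0 k) a rho v rho0 (fun w wr => (diff_coord k (df w wr)).1).
apply: (proj1 (near_diff rho0 _ D)) => y yr.
by rewrite (diff_coord k (df y yr)).2.
Qed.

Lemma diff_line V W (F : V -> W) (x : V) (s : C R) : differentiable F (s *: x) ->
  differentiable (fun s : C R => F (s *: x)) s /\
  'd (fun s : C R => F (s *: x)) s 1 = 'd F (s *: x) x.
Proof.
move=> dF; have [K K0 HK] := diff_bound dF.
have [] := @has_diff_eps_linear _ _ _ (fun s : C R => F (s *: x)) s (fun h => 'd F (s *: x) (h *: x)) (K * rnorm x).
- by move=> c u v; rewrite scalerDl -scalerA linearD linearZ_LR.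
- by move=> h; apply: le_trans (HK _) _; rewrite rnormZ mulrCA mulrC.
- move=> e e0; have x1 : 0 < rnorm x + 1 by rewrite ltr_wpDl ?rnorm_ge0.
  have [d d0 Hd] := diff_has_diff_eps dF (divr_gt0 e0 x1).
  exists (d / (rnorm x + 1)); first exact: divr_gt0.
  move=> h hd; have hx : rnorm (h *: x) < d.
    rewrite rnormZ; apply: le_lt_trans (_ : _ <= rnorm h * (rnorm x + 1)) _.
      by rewrite ler_wpM2l ?rnorm_ge0 // lerDl.
    by rewrite -ltr_pdivlMr.
  rewrite scalerDl; apply: le_trans (Hd _ hx) _.
  rewrite rnormZ mulrCA mulrC ler_wpM2r ?rnorm_ge0 // -mulrA ler_piMr ?(ltW e0) //.
  by rewrite mulrC ler_pdivrMr // mul1r lerDl.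
move=> dl E; split; first exact: dl.
exact: (etrans (congr1 (fun g : C R -> W => g 1) E) (congr1 ('d F (s *: x)) (scale1r x))).
Qed.

End Smooth.

(** * Coefficient bound and maximum principle *)

Section Caratheodory.
Variable R : realType.
Implicit Types (V W : normedModType (C R)) (m : nat) (r t : R).

Lemma ccvg_le2 (u w : nat -> C R) l l' M0 : cconverges u l -> cconverges w l' ->
  (forall m, (M0 <= m)%N -> rnorm (u m) <= rnorm (w m)) -> rnorm l <= rnorm l'.
Proof.
move=> ul wl H; apply/ler_addgt0Pr => e e0; have e2 : 0 < e / 2 by rewrite divr_gt0.
have [M HM] := ul _ e2; have [M' HM'] := wl _ e2.
set m := maxn M0 (maxn M M').
have m0 : (M0 <= m)%N by rewrite leq_maxl.
have m1 : (M <= m)%N by rewrite /m maxnCA leq_maxl.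
have m2 : (M' <= m)%N by rewrite /m (maxnC M) maxnCA leq_maxl.
have h1 : rnorm l <= rnorm (u m) + e / 2.
  have -> : l = u m - (u m - l) by ring.
  by apply: le_trans (rnormB _ _) (lerD (lexx _) (HM _ m1)).
have h2 : rnorm (w m) <= rnorm l' + e / 2.
  have -> : w m = l' + (w m - l') by ring.
  by apply: le_trans (rnormD _ _) (lerD (lexx _) (HM' _ m2)).
have h3 := H _ m0; lra.
Qed.

(** The majorant appears both as a real function [g], for the pointwise bound, and as a complex
    function [H], whose mean can be computed from those of [p] and its conjugate. *)
Lemma mean_le_pos m r (G H : C R -> C R) (g : C R -> R) : 0 <= r ->
  (forall z, rnorm z = r -> rnorm (G z) <= g z) ->
  (forall z, rnorm z = r -> H z = rc (g z)) -> rnorm (mean m r G) <= rnorm (mean m r H).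
Proof.
move=> r0 HG HH; rewrite /mean !rnormM ler_wpM2r ?rnorm_ge0 //.
have -> : \sum_(k < 2 ^ m) H (rc r * circ (k%:R / 2 ^+ m)) =
    \sum_(k < 2 ^ m) rc (g (rc r * circ (k%:R / 2 ^+ m))).
  by apply: eq_bigr => k _; apply: HH; rewrite rnorm_circM.
rewrite -rc_sum rnorm_rc; apply: le_trans (rnorm_sum _ _ _) (le_trans _ (ler_norm _)).
by apply: ler_sum => k _; apply: HG; rewrite rnorm_circM.
Qed.

Lemma differentiable_mulC (f g : C R -> C R) s : differentiable f s -> differentiable g s ->
  differentiable (fun z => f z * g z) s.
Proof. by move=> df dg; have := differentiableM df dg. Qed.
Lemma differentiable_addC (f g : C R -> C R) s : differentiable f s -> differentiable g s ->
  differentiable (fun z => f z + g z) s.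
Proof. by move=> df dg; have := differentiableD df dg. Qed.
Lemma differentiable_invC (f : C R -> C R) s : differentiable f s -> f s != 0 ->
  differentiable (fun z => (f z)^-1) s.
Proof. by move=> df f0; have := differentiableV df f0. Qed.
Lemma differentiable_cstC (c s : C R) : differentiable (fun _ : C R => c) s.
Proof. exact: differentiable_cst. Qed.
Lemma differentiable_idC (s : C R) : differentiable (fun z : C R => z) s.
Proof. exact: (@ex_diff _ _ _ _ _ _ _ (is_diff_id s)). Qed.
Lemma differentiable_expC (f : C R -> C R) s k : differentiable f s -> differentiable (fun z => f z ^+ k) s.
Proof.
move=> df; elim: k => [|k IH]; first exact: differentiable_cstC.
by rewrite (_ : (fun z => _) = (fun z => f z * f z ^+ k)); [exact: differentiable_mulC|apply/funext => z; rewrite exprS].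
Qed.
Lemma differentiable_sumC (I : Type) (l : seq I) (P : pred I) (F : I -> C R -> C R) s :
  (forall i, differentiable (F i) s) -> differentiable (fun z => \sum_(i <- l | P i) F i z) s.
Proof.
move=> dF; elim: l => [|i l IH].
  by rewrite (_ : (fun z => _) = (fun=> 0)); [exact: differentiable_cstC|apply/funext => z; rewrite big_nil].
rewrite (_ : (fun z => _) = (fun z => (if P i then F i z else 0) + \sum_(j <- l | P j) F j z)).
  by apply: differentiable_addC => //; case: (P i); [exact: dF|exact: differentiable_cstC].
by apply/funext => z; rewrite big_cons; case: (P i); rewrite ?add0r.
Qed.
Lemma differentiable_prodC (I : Type) (l : seq I) (P : pred I) (F : I -> C R -> C R) s :
  (forall i, differentiable (F i) s) -> differentiable (fun z => \prod_(i <- l | P i) F i z) s.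
Proof.
move=> dF; elim: l => [|i l IH].
  by rewrite (_ : (fun z => _) = (fun=> 1)); [exact: differentiable_cstC|apply/funext => z; rewrite big_nil].
rewrite (_ : (fun z => _) = (fun z => (if P i then F i z else 1) * \prod_(j <- l | P j) F j z)).
  by apply: differentiable_mulC => //; case: (P i); [exact: dF|exact: differentiable_cstC].
by apply/funext => z; rewrite big_cons; case: (P i); rewrite ?mul1r.
Qed.
Lemma differentiable_detC n (M : C R -> 'M[C R]_n) s : (forall i j, differentiable (fun z => M z i j) s) ->
  differentiable (fun z => \det (M z)) s.
Proof.
move=> dM'; apply: differentiable_sumC => p; apply: differentiable_mulC; first exact: differentiable_cstC.
by apply: differentiable_prodC => i; exact: dM'.
Qed.

(** By the adjugate formula the entry is a rational expression in the entries of [q] and [M].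
    [invmx] agrees with it only at invertible matrices, so the two are compared on a small disc
    around [s]. *)
Lemma differentiable_mulmx_inv n (q : C R -> 'rV[C R]_n) (M : C R -> 'M[C R]_n) (rho : R) s k :
  rnorm s < rho ->
  (forall z, rnorm z < rho -> M z \in unitmx) ->
  (forall j, differentiable (fun z => q z 0 j) s) ->
  (forall i j, differentiable (fun z => M z i j) s) ->
  differentiable (fun z => (q z *m invmx (M z)) 0 k) s.
Proof.
move=> sr uM dq dM'.
have D : differentiable (fun z => \sum_j q z 0 j * ((\det (M z))^-1 * cofactor (M z) k j)) s.
  apply: differentiable_sumC => j; apply: differentiable_mulC => //; apply: differentiable_mulC.
    apply: differentiable_invC; first exact: differentiable_detC.
    by have := uM _ sr; rewrite unitmxE unitfE.
  apply: differentiable_mulC; first exact: differentiable_cstC.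
  apply: differentiable_detC => a b.
  rewrite (_ : (fun z => _) = (fun z => M z (lift k a) (lift j b))); first exact: dM'.
  by apply/funext => z; rewrite !mxE.
have d0 : 0 < rho - rnorm s by rewrite subr_gt0.
apply: (proj1 (near_diff d0 _ D)) => z zs.
have zr : rnorm z < rho.
  rewrite (_ : z = s + (z - s)); last by ring.
  by apply: le_lt_trans (rnormD _ _) _; rewrite -ltrBrDl.
by rewrite mxE; apply: eq_bigr => j _; rewrite /invmx uM // !mxE.
Qed.

(* Adding the mean of [conj p * z ^- 2], which vanishes in the limit, turns the
   second coefficient into a mean of [2 * (Re p - alpha) * z ^- 2]. *)
Lemma caratheodory (p : C R -> C R) (alpha : R) b1 b2 : alpha <= 1 ->
  (forall z, z != 0 -> rnorm z < 1 -> differentiable p z /\ alpha <= reC (p z)) ->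
  (forall e : R, 0 < e -> exists2 d : R, 0 < d & forall z, z != 0 -> rnorm z < d ->
     rnorm (p z - (1 + z * b1 + z ^+ 2 * b2)) <= e * rnorm z ^+ 2) ->
  rnorm b2 <= 2 * (1 - alpha).
Proof.
move=> a1 Hp Hb.
have dp z : z != 0 -> rnorm z < 1 -> differentiable p z by move=> z0 z1; have [] := Hp z z0 z1.
pose B := 1 + rnorm b1 + rnorm b2.
have B0 : 0 < B by rewrite /B -addrA ltr_pwDl // addr_ge0 ?rnorm_ge0.
have [d0 d00 Hd0] : exists2 d : R, 0 < d & forall z, z != 0 -> rnorm z < d ->
    rnorm z <= 1 /\ rnorm (p z - 1) <= B * rnorm z.
  have [d d0 Hd] := Hb 1 ltr01; exists (Num.min d 1); first by rewrite lt_min d0 ltr01.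
  move=> z z0; rewrite lt_min => /andP[/(Hd z z0) zd /ltW z1]; split=> //.
  have -> : p z - 1 = (p z - (1 + z * b1 + z ^+ 2 * b2)) + (z * b1 + z ^+ 2 * b2) by ring.
  apply: le_trans (rnormD _ _) (le_trans (lerD zd (rnormD _ _)) _).
  rewrite (rnormM z) (rnormM (z ^+ 2)) (rnormX z) mul1r /B.
  have n0 := rnorm_ge0 z; have n1 := rnorm_ge0 b1; have n2 := rnorm_ge0 b2.
  have zz : rnorm z ^+ 2 <= rnorm z by rewrite expr2 ler_piMl.
  have : rnorm z ^+ 2 * rnorm b2 <= rnorm z * rnorm b2 by rewrite ler_wpM2r.
  lra.
(* The passage r -> 1 is made by one choice: if the bound failed with ratio [q < 1], then r =
   [(1 + q) / 2] satisfies r^2 - q = ((1 - q) / 2)^2 > 0, a contradiction. *)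
suff HH r : 0 < r -> r < 1 -> r ^+ 2 * rnorm b2 <= 2 * (1 - alpha).
  rewrite leNgt; apply/negP => lt.
  set x := rnorm b2 in HH lt *; set y := 2 * (1 - alpha) in HH lt *.
  have y0 : 0 <= y by rewrite mulr_ge0 // subr_ge0.
  have x0 : 0 < x by apply: le_lt_trans lt.
  have q1 : y / x < 1 by rewrite ltr_pdivrMr // mul1r.
  have q0 : 0 <= y / x by rewrite divr_ge0 // ltW.
  set q := y / x in q0 q1.
  have yE : y = q * x by rewrite /q divfK // gt_eqF.
  have /HH : 0 < (1 + q) / 2 by lra.
  have r1 : (1 + q) / 2 < 1 by lra.
  move=> /(_ r1); rewrite yE ler_pM2r // => h.
  have : 0 < ((1 - q) / 2) ^+ 2 by rewrite exprn_gt0 // divr_gt0 // subr_gt0.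
  have -> : ((1 - q) / 2) ^+ 2 = ((1 + q) / 2) ^+ 2 - q by field.
  lra.
move=> r0 r1.
have A : cconverges (fun m => mean m r p) 1.
  apply: (@mean_cvg _ p 1 1 0 0) => // e e0.
  exists (Num.min d0 (e / B)); first by rewrite lt_min d00 divr_gt0.
  move=> z z0; rewrite lt_min => /andP[/(Hd0 z z0)[_ h] zB].
  rewrite !mul0r !addr0; apply: le_trans h _.
  by rewrite mulrC -ler_pdivlMr // ltW.
have Bc : cconverges (fun m => mean m r (fun z => p z / z ^+ 2)) b2.
  apply: (@mean_cvg _ _ 1 b2 b1 1) => //.
    move=> z z0 z1; apply: differentiable_mulC; first exact: dp.
    by apply: differentiable_invC; [apply: differentiable_expC; exact: differentiable_idC|rewrite expf_neq0].
  move=> e e0; have [d d1 Hd] := Hb e e0; exists d => // z z0 zd.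
  have -> : p z / z ^+ 2 - (b2 + b1 / z + 1 / z ^+ 2) =
     (p z - (1 + z * b1 + z ^+ 2 * b2)) / z ^+ 2 by field.
  by rewrite (rnormM _ (_ ^-1)) rnormV (rnormX z) ler_pdivrMr ?exprn_gt0 ?rnorm_gt0 // Hd.
have Cc : cconverges (fun m => mean m r (fun z => p z * z ^+ 2)) 0.
  apply: (@mean_cvg _ _ 1 0 0 0) => //.
    move=> z z0 z1; apply: differentiable_mulC; first exact: dp.
    by apply: differentiable_expC; exact: differentiable_idC.
  move=> e e0; have B1 : 0 < B + 1 by rewrite addr_gt0.
  exists (Num.min d0 (e / (B + 1))); first by rewrite lt_min d00 divr_gt0.
  move=> z z0; rewrite lt_min => /andP[/(Hd0 z z0)[z1 h] zB].
  rewrite !mul0r !addr0 subr0 (rnormM (p z)) (rnormX z).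
  have h' : rnorm (p z) <= B + 1.
    rewrite (_ : p z = (p z - 1) + 1); last by ring.
    apply: le_trans (rnormD _ _) _; rewrite rnorm1 lerD2r; apply: le_trans h _.
    by rewrite ler_piMr // ltW.
  apply: le_trans (_ : _ <= (B + 1) * rnorm z) _.
    apply: ler_pM => //; rewrite ?rnorm_ge0 ?exprn_ge0 ?rnorm_ge0 //.
    by rewrite expr2 ler_piMl ?rnorm_ge0.
  by rewrite mulrC -ler_pdivlMr // ltW.
have rn : rc r != 0 by rewrite rc_eq0 gt_eqF.
pose G z := rc r ^+ 2 * (p z / z ^+ 2) + rc r ^- 2 * (p z * z ^+ 2)^* + (- rc (2 * alpha) * rc r ^+ 2) * z ^- 2.
(* On the circle conj z = r^2 / z, so the conjugated term, a positive power, acquires the factor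
   [z ^- 2] of the other two. *)
have GE z : rnorm z = r -> G z = rc (2 * (reC (p z) - alpha)) * rc r ^+ 2 / z ^+ 2.
  move=> zr; have z0 : z != 0 by rewrite -rnorm_gt0 zr.
  have cz : z^* = rc r ^+ 2 / z.
    by apply: (mulfI z0); rewrite mul_conj zr rcX mulrCA divff // mulr1.
  rewrite /G rmorphM rmorphXn /= cz.
  have -> : rc (2 * (reC (p z) - alpha)) = p z + (p z)^* - rc (2 * alpha).
    by rewrite mulrBr rcB add_conj.
  by field; rewrite z0 rn.
have G1 : cconverges (fun m => mean m r G) (rc r ^+ 2 * b2).
  have -> : rc r ^+ 2 * b2 = rc r ^+ 2 * b2 + rc r ^- 2 * (0 : C R)^* + (- rc (2 * alpha) * rc r ^+ 2) * 0.
    by rewrite rmorph0; ring.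
  rewrite (_ : (fun m => mean m r G) = (fun m => rc r ^+ 2 * mean m r (fun z => p z / z ^+ 2) +
     rc r ^- 2 * (mean m r (fun z => p z * z ^+ 2))^* + (- rc (2 * alpha) * rc r ^+ 2) * mean m r (fun z => z ^- 2))).
    apply: ccvgD; [apply: ccvgD; apply: ccvgZ => //; exact: ccvg_conj|apply: ccvgZ].
    move=> e e0; exists 3%N => m m3; rewrite mean_expV // ?subrr ?rnorm0 ?ltW //.
    by apply: (@leq_trans (2 ^ 3)%N); rewrite // leq_pexp2l.
  by apply/funext => m; rewrite /G !meanD !meanZ mean_conj.
have H1 : cconverges (fun m => mean m r (fun z => p z + (p z)^* + - rc (2 * alpha))) (1 + 1^* + - rc (2 * alpha)).
  rewrite (_ : (fun m => _) = (fun m => mean m r p + (mean m r p)^* + - rc (2 * alpha))).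
    apply: ccvgD; first by apply: ccvgD => //; exact: ccvg_conj.
    by move=> e e0; exists 0%N => m _; rewrite subrr rnorm0 ltW.
  by apply/funext => m; rewrite !meanD mean_cst mean_conj.
have := ccvg_le2 (M0 := 0) G1 H1.
rewrite (rnormM (rc r ^+ 2)) (rnormX (rc r)) rnorm_rc gtr0_norm // rmorph1.
have -> : 1 + 1 + - rc (2 * alpha) = rc (2 * (1 - alpha)) :> C R.
  by rewrite mulrBr mulr1 rcB rc_nat; ring.
rewrite rnorm_rc ger0_norm; last by rewrite mulr_ge0 // subr_ge0.
apply=> m _; apply: (@mean_le_pos _ _ _ _ (fun z => 2 * (reC (p z) - alpha))); first exact: ltW.
  move=> z zr; have z0 : z != 0 by rewrite -rnorm_gt0 zr.
  have z1 : rnorm z < 1 by rewrite zr.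
  have [_ pa] := Hp z z0 z1.
  rewrite GE // (rnormM _ (_ ^-1)) (rnormM _ (rc r ^+ 2)) rnormV (rnormX z) (rnormX (rc r)) zr !rnorm_rc ger0_norm ?(gtr0_norm r0).
    by rewrite mulfK // expf_neq0 // gt_eqF.
  by rewrite mulr_ge0 // subr_ge0.
by move=> z zr; rewrite mulrBr rcB add_conj.
Qed.

(* Mean over the unit circle of [g] composed with the automorphism of the disc
   sending [0] to [s]. *)
Lemma disc_max (g : C R -> C R) (K : R) s : (forall z, differentiable g z) ->
  (forall z, rnorm z = 1 -> rnorm (g z) <= K) -> rnorm s <= 1 -> rnorm (g s) <= K.
Proof.
move=> dg gK; rewrite le_eqVlt => /orP[/eqP/gK//|s1].
pose phi z := (z + s) / (1 + s^* * z).
(* A radius above 1 that stays below the modulus 1 / |s| of the pole of [phi]; it also makes sense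
   at [s = 0]. *)
pose rho := 2 / (1 + rnorm s).
have n0 := rnorm_ge0 s; have p0 : 0 < 1 + rnorm s by lra.
have rho1 : 1 < rho by rewrite ltr_pdivlMr // mul1r; lra.
have den z : rnorm z < rho -> 1 + s^* * z != 0.
  move=> zr; apply/eqP => E.
  have : rnorm (s^* * z) = 1.
    by rewrite (_ : s^* * z = (1 + s^* * z) - 1); [rewrite E sub0r rnormN rnorm1|ring].
  rewrite rnormM rnorm_conj => E'.
  have : rnorm s * rnorm z <= rnorm s * rho by rewrite ler_wpM2l // ltW.
  have : rnorm s * rho < 1 by rewrite mulrA ltr_pdivrMr // mul1r; lra.
  by rewrite E'; lra.
have dphi z : rnorm z < rho -> differentiable phi z.
  move=> zr; apply: differentiable_mulC; first by apply: differentiable_addC; [exact: differentiable_idC|exact: differentiable_cstC].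
  apply: differentiable_invC; last exact: den.
  by apply: differentiable_addC; [exact: differentiable_cstC|apply: differentiable_mulC; [exact: differentiable_cstC|exact: differentiable_idC]].
have dG z : rnorm z < rho -> differentiable (g \o phi) z.
  by move=> zr; exact: (@differentiable_comp _ _ _ _ phi g z (dphi z zr) (dg _)).
have cv : cconverges (fun m => mean m 1 (g \o phi)) (g s).
  apply: (@mean_cvg _ _ rho (g s) 0 0) => //; first by move=> z _; exact: dG.
  have z0 : rnorm (0 : C R) < rho by rewrite rnorm0 (lt_trans ltr01).
  have /cvg_rnorm ct := differentiable_continuous (dG 0 z0).
  move=> e e0; have [d d0 Hd] := ct e e0; exists d => // z _ /Hd.
  by rewrite add0r !mul0r !addr0 /= {2}/phi mulr0 add0r addr0 divr1.
apply: (@ccvg_le _ _ _ _ 0%N cv) => m _; apply: mean_bound => // z z1; apply: gK.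
rewrite /phi rnormM rnormV.
(* With z conj z = 1, numerator and denominator of [phi] have the same modulus, so the unit circle
   is preserved. *)
have -> : z + s = z * (1 + s^* * z)^*.
  have -> : (1 + s^* * z)^* = 1 + s * z^* by rewrite rmorphD rmorphM rmorph1 /= conjCK.
  by rewrite mulrDr mulr1 mulrCA mul_conj z1 expr1n rc1 mulr1.
rewrite rnormM rnorm_conj z1 mul1r divff // rnorm_eq0.
by apply: den; rewrite z1.
Qed.

Lemma polydisk_max n (F : 'rV[C R]_n -> C R) (K : R) :
  (forall a b z, differentiable (fun s : C R => F (a + s *: b)) z) ->
  (forall x : 'rV[C R]_n, (forall k, rnorm (x 0 k) = 1) -> rnorm (F x) <= K) ->
  forall x : 'rV[C R]_n, (forall k, rnorm (x 0 k) <= 1) -> rnorm (F x) <= K.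
Proof.
move=> dF FK.
(* [j] counts the leading coordinates already freed from the unit circle. Each step lets one more
   coordinate vary and applies [disc_max] to it; past [n] nothing changes. *)
suff H j (x : 'rV[C R]_n) : (forall k, rnorm (x 0 k) <= 1) ->
    (forall k : 'I_n, (j <= k)%N -> rnorm (x 0 k) = 1) -> rnorm (F x) <= K.
  move=> x x1; apply: (H n x x1) => k; by rewrite leqNgt ltn_ord.
elim: j x => [|j IH] x x1 xj; first by apply: FK => k; exact: xj.
have [jn|nj] := ltnP j n; last first.
  by apply: IH => // k; rewrite leqNgt (leq_trans (ltn_ord k)).
pose i := Ordinal jn; pose b : 'rV[C R]_n := delta_mx 0 i.
pose a := x - x 0 i *: b.
have up (s : C R) k : (a + s *: b) 0 k = if k == i then s else x 0 k.
  rewrite !mxE eqxx /= ; case: eqP => [->|_]; rewrite ?mulr1 ?mulr0 ?subr0 ?addr0 //; ring.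
have -> : x = a + x 0 i *: b by rewrite subrK.
apply: (@disc_max (fun s => F (a + s *: b))); [exact: dF| |exact: x1].
move=> s s1; apply: IH => k; rewrite up; case: eqP => [_|ki]; rewrite ?s1 // => jk.
apply: xj; rewrite ltn_neqAle jk andbT; apply/eqP => E; apply: ki; exact: val_inj.
Qed.
End Caratheodory.

(** * Upper bound *)

Section UpperBound.
Variable R : realType.
Implicit Types (V W : normedModType (C R)) (m : nat) (r t : R).

Lemma diff_scale_add V W (f g : V -> W) c x : differentiable f x -> differentiable g x ->
  differentiable (fun y => c *: f y + g y) x /\
  forall v, 'd (fun y => c *: f y + g y) x v = c *: 'd f x v + 'd g x v.
Proof.
have linP (A B : {linear V -> W}) : linear (fun v => c *: A v + B v).
  move=> a u v; rewrite (linearD A) (linearD B) !linearZ_LR !scalerDr !scalerA (mulrC a).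
  by rewrite addrACA.
move=> df dg; have [k k0 Hk] := diff_bound df; have [k' k0' Hk'] := diff_bound dg.
have {df} df := diff_has_diff_eps df; have {dg} dg := diff_has_diff_eps dg.
move: ('d f x) ('d g x) Hk Hk' df dg => A B Hk Hk' df dg.
have [] := @has_diff_eps_linear _ _ _ (fun y => c *: f y + g y) x (fun v => c *: A v + B v) (rnorm c * k + k').
- exact: linP.
- move=> h; apply: le_trans (rnormD _ _) _; rewrite rnormZ mulrDl lerD //.
  by rewrite -mulrA ler_wpM2l ?rnorm_ge0.
- move=> e e0; have c1 : 0 < rnorm c + 1 by rewrite ltr_wpDl ?rnorm_ge0.
  have e1 : 0 < e / 2 / (rnorm c + 1) by rewrite !divr_gt0.
  have e2 : 0 < e / 2 by rewrite divr_gt0.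
  have [d d0 Hd] := df _ e1; have [d' d0' Hd'] := dg _ e2.
  exists (Num.min d d'); first by rewrite lt_min d0.
  move=> h; rewrite lt_min => /andP[/Hd hd /Hd' hd'].
  have -> : c *: f (x + h) + g (x + h) - (c *: f x + g x) - (c *: A h + B h) =
     c *: (f (x + h) - f x - A h) + (g (x + h) - g x - B h).
    by rewrite !scalerBr (opprD (c *: f x)) (addrACA (c *: f (x + h))) (opprD (c *: A h)) (addrACA (_ - _)).
  have h1 : rnorm (c *: (f (x + h) - f x - A h)) <= e / 2 * rnorm h.
    rewrite rnormZ; apply: le_trans (ler_wpM2l (rnorm_ge0 _) hd) _.
    rewrite mulrA ler_wpM2r ?rnorm_ge0 // mulrCA ler_piMr ?(ltW e2) //.
    by rewrite ler_pdivrMr // mul1r lerDl.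
  by apply: le_trans (rnormD _ _) (le_trans (lerD h1 hd') _); lra.
by move=> dB eB; split=> // v; rewrite eB.
Qed.

Lemma jacobian_mul n (f : 'rV[C R]_n -> 'rV[C R]_n) x v : 'd f x v = v *m 'J f x.
Proof. by rewrite /jacobian mul_rV_lin1. Qed.

Section Holomorphic.
Variables (n : nat) (f : 'rV[C R]_n -> 'rV[C R]_n).
Implicit Types (x u v w : 'rV[C R]_n) (c : C R) (us vs : seq 'rV[C R]_n).
Hypothesis hf : holomorphic f.

Lemma polydisk_ball x : polydisk x -> exists2 d : R, 0 < d &
  forall y : 'rV[C R]_n, rnorm (y - x) < d -> polydisk y.
Proof.
rewrite /polydisk /= => x1; exists (1 - rnorm x); first by rewrite subr_gt0.
move=> y yx; rewrite /= -(subrK x y); apply: le_lt_trans (rnormD _ _) _.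
by rewrite -ltrBrDr.
Qed.

(** Each differentiation preserves holomorphy on the open polydisc by [diff_derivative_rV], so one
    complex derivative gives all orders. *)
Lemma frechet_diff vs x : polydisk x -> differentiable (fun y => frechet f y vs) x.
Proof.
elim: vs x => [|v vs IH] x px; first exact: hf.
have [d d0 Hd] := polydisk_ball px.
apply: (@diff_derivative_rV _ _ _ (fun y => frechet f y vs) x d v d0) => w wd.
by apply: IH; exact: Hd.
Qed.

(** In the outermost slot this is linearity of a differential. For an inner slot the identity holds
    at all points near [x], so it can be differentiated along the directions [us] outside it. *)
Lemma frechetP us vs c v1 v2 x : polydisk x ->
  frechet f x (us ++ (c *: v1 + v2) :: vs) =
  c *: frechet f x (us ++ v1 :: vs) + frechet f x (us ++ v2 :: vs).
Proof.
elim: us x => [|u us IH] x px /=; first by rewrite linearD linearZ_LR.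
have [d d0 Hd] := polydisk_ball px.
have [dP eP] := diff_scale_add c (frechet_diff (us ++ v1 :: vs) px) (frechet_diff (us ++ v2 :: vs) px).
have E y : rnorm (y - x) < d -> c *: frechet f y (us ++ v1 :: vs) + frechet f y (us ++ v2 :: vs)
    = frechet f y (us ++ (c *: v1 + v2) :: vs).
  by move=> /Hd/IH ->.
have [_ e] := near_diff d0 E dP.
exact: (etrans (congr1 (fun A : 'rV[C R]_n -> 'rV[C R]_n => A u) e) (eP u)).
Qed.

Lemma frechet0 us vs x : polydisk x -> frechet f x (us ++ 0 :: vs) = 0.
Proof.
move=> px; have := @frechetP us vs (-1) 0 0 x px.
by rewrite scaler0 addr0 scaleN1r addNr.
Qed.

Lemma frechetZ us vs c v x : polydisk x ->
  frechet f x (us ++ (c *: v) :: vs) = c *: frechet f x (us ++ v :: vs).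
Proof.
by move=> px; have := @frechetP us vs c v 0 x px; rewrite addr0 frechet0 // addr0.
Qed.

Lemma polydiskZ (x : 'rV[C R]_n) (s : C R) : rnorm x <= 1 -> rnorm s < 1 -> polydisk (s *: x).
Proof.
move=> x1 s1; rewrite /polydisk /= rnormZ; apply: le_lt_trans s1.
by rewrite ler_piMr ?rnorm_ge0.
Qed.

Lemma polydisk0 : polydisk (0 : 'rV[C R]_n).
Proof. by rewrite /polydisk /= rnorm0. Qed.

Lemma frechet_taylor1 vs x : rnorm x <= 1 -> forall e : R, 0 < e ->
  exists2 d : R, 0 < d & forall s : C R, rnorm s < d ->
    rnorm (frechet f (s *: x) vs - (frechet f 0 vs + s *: frechet f 0 (x :: vs))) <= e * rnorm s.
Proof.
move=> x1 e e0; have [d d0 Hd] := diff_has_diff_eps (frechet_diff vs polydisk0) e0.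
exists d => // s sd; have sx : rnorm (s *: x) <= rnorm s by rewrite rnormZ ler_piMr ?rnorm_ge0.
have := Hd (s *: x) (le_lt_trans sx sd); rewrite add0r linearZ_LR opprD addrA => h.
apply: le_trans h _; by rewrite ler_wpM2l // ltW.
Qed.

Lemma frechet_taylor0 vs x : rnorm x <= 1 -> forall e : R, 0 < e ->
  exists2 d : R, 0 < d & forall s : C R, rnorm s < d ->
    rnorm (frechet f (s *: x) vs - frechet f 0 vs) <= e.
Proof.
move=> x1 e e0.
have /cvg_rnorm/(_ e e0)[d d0 Hd] := differentiable_continuous (frechet_diff vs polydisk0).
exists d => // s sd; have sx : rnorm (s *: x) <= rnorm s by rewrite rnormZ ler_piMr ?rnorm_ge0.
by have := Hd (s *: x) (le_lt_trans sx sd); rewrite add0r.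
Qed.

Lemma frechet1_0 v : 'J f 0 = 1%:M -> frechet f 0 [:: v] = v.
Proof. by move=> J1; rewrite -[LHS]/('d f 0 v) jacobian_mul J1 mulmx1. Qed.

(** [Df(sx)] moves each basis vector by at most 1 / (2 (n + 1)), hence moves [E] by at most half its
    norm. This bounds a vector by its image, so that the inverse derivative need never be
    expanded. *)
Lemma derivative_near_id x : 'J f 0 = 1%:M -> rnorm x <= 1 ->
  exists2 d : R, 0 < d & forall s : C R, rnorm s < d -> forall E : 'rV[C R]_n,
    rnorm E <= 2 * rnorm (frechet f (s *: x) [:: E]).
Proof.
move=> J1 x1; have k0 : 0 < (2 * (n%:R + 1))^-1 :> R.
  by rewrite invr_gt0 mulr_gt0 // ltr_wpDl.
have [d d0 Hd] := finite_near (fun i : 'I_n => frechet_taylor0 [:: delta_mx 0 i] x1 k0).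
exists d => // s sd E.
have [A AE] : exists A : {linear 'rV[C R]_n -> 'rV[C R]_n}, forall v, frechet f (s *: x) [:: v] = A v.
  by exists ('d (fun y => f y) (s *: x)).
rewrite AE.
have EE : E - A E = \sum_i E 0 i *: (delta_mx 0 i - A (delta_mx 0 i)).
  rewrite {1 2}(row_sum_delta E) linear_sum -sumrB; apply: eq_bigr => i _.
  by rewrite linearZ_LR scalerBr.
have h : rnorm (E - A E) <= rnorm E / 2.
  rewrite EE; apply: le_trans (rnorm_sum _ _ _) _.
  apply: (@le_trans _ _ (\sum_(i < n) rnorm E * (2 * (n%:R + 1))^-1)).
    apply: ler_sum => i _; rewrite rnormZ; apply: ler_pM; rewrite ?rnorm_ge0 ?rnorm_coord //.
    by have := Hd s sd i; rewrite AE (frechet1_0 _ J1) rnormBC.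
  rewrite sumr_const card_ord -(mulr_natr (_ * _)) -mulrA ler_wpM2l ?rnorm_ge0 //.
  rewrite mulrC ler_pdivrMr ?mulr_gt0 ?ltr_wpDl // mulrA mulVf ?mul1r ?lerDl //.
have {EE} : rnorm E <= rnorm (E - A E) + rnorm (A E).
  by rewrite -{1}(subrK (A E) E) rnormD.
lra.
Qed.

(** Six times [third_order_functional], as (2/3) (1/2) (1/2) = 1/6 = 1/3!. *)
Definition cubic (x : 'rV[C R]_n) : 'rV[C R]_n :=
  frechet f 0 [:: x; x; x] - frechet f 0 [:: x; frechet f 0 [:: x; x]].

(* The power series of [(Df (s x))^-1 (D^2 f (s x) (s x)^2 + Df (s x) (s x)) / s]. *)
Lemma radial_expansion x (P : C R -> 'rV[C R]_n) : 'J f 0 = 1%:M -> rnorm x <= 1 ->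
  (forall s : C R, rnorm s < 1 -> frechet f (s *: x) [:: P s] =
     s *: frechet f (s *: x) [:: x; x] + frechet f (s *: x) [:: x]) ->
  forall e : R, 0 < e -> exists2 d : R, 0 < d & forall s : C R, rnorm s < d ->
    rnorm (P s - (x + s *: frechet f 0 [:: x; x] + s ^+ 2 *: cubic x)) <= e * rnorm s ^+ 2.
Proof.
move=> J1 x1 HP e e0.
have d0E v := frechet1_0 v J1.
set D2 := frechet f 0 [:: x; x]; set P2 := cubic x; set D3 := frechet f 0 [:: x; x; x].
set B := frechet f 0 [:: x; D2].
have P2E : P2 = D3 - B by [].
(* Three remainders of this size, doubled by [derivative_near_id], stay below [e]. *)
have e8 : 0 < e / 8 by rewrite divr_gt0.
have [d1 d10 H1] := frechet_taylor1 [:: x; x] x1 e8.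
have [d3 d30 H3] := frechet_taylor1 [:: D2] x1 e8.
have [d4 d40 H4] := frechet_taylor0 [:: P2] x1 e8.
have [d5 d50 H5] := derivative_near_id J1 x1.
exists (Num.min d1 (Num.min (Num.min d3 d4) (Num.min d5 1))).
  by rewrite !lt_min d10 d30 d40 d50 ltr01.
move=> s; rewrite !lt_min => /andP[s1 /andP[/andP[s3 s4] /andP[s5 s6]]].
apply: le_trans (H5 s s5 _) _.
move: (H1 s s1) (H3 s s3) (H4 s s4) (HP s s6); rewrite !d0E -/D2 -/D3 -/B -/P2.
have [A AE] : exists A : {linear 'rV[C R]_n -> 'rV[C R]_n}, forall v, frechet f (s *: x) [:: v] = A v.
  by exists ('d (fun y => f y) (s *: x)).
rewrite !AE; move: (frechet f (s *: x) [:: x; x]) => q h1 h3 h4 AP.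
clear H1 H3 H4 H5 HP; clearbody D2 D3 B P2.
(* Applying [Df(sx)] to the error replaces [P s] by its defining right-hand side. Since
   [P2 = D3 - B], only Taylor remainders of order one, multiplied by [s], and of order zero,
   multiplied by [s ^+ 2], are left. *)
have -> : A (P s - (x + s *: D2 + s ^+ 2 *: P2)) =
    s *: (q - (D2 + s *: D3)) - s *: (A D2 - (D2 + s *: B)) - s ^+ 2 *: (A P2 - P2).
  rewrite (linearB A) (linearD A) (linearD A x) !linearZ_LR AP P2E.
  by move: (A x) (A D2) (A (D3 - B)) => a a2 a3; apply/rowP => k; rewrite !mxE; ring.
have n0 := rnorm_ge0 s.
have g1 : rnorm (s *: (q - (D2 + s *: D3))) <= e / 8 * rnorm s ^+ 2.
  rewrite rnormZ; apply: le_trans (ler_wpM2l n0 h1) _; rewrite le_eqVlt; apply/orP; left.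
  by apply/eqP; ring.
have g3 : rnorm (s *: (A D2 - (D2 + s *: B))) <= e / 8 * rnorm s ^+ 2.
  rewrite rnormZ; apply: le_trans (ler_wpM2l n0 h3) _; rewrite le_eqVlt; apply/orP; left.
  by apply/eqP; ring.
have g4 : rnorm (s ^+ 2 *: (A P2 - P2)) <= e / 8 * rnorm s ^+ 2.
  by rewrite rnormZ rnormX mulrC ler_wpM2r ?exprn_ge0.
move: (s *: (q - _)) (s *: (A D2 - _)) (s ^+ 2 *: _) g1 g3 g4 => t1 t3 t4 g1 g3 g4.
have : rnorm (t1 - t3 - t4) <= e / 8 * rnorm s ^+ 2 + e / 8 * rnorm s ^+ 2 + e / 8 * rnorm s ^+ 2.
  by apply: le_trans (rnormB _ _) _; apply: lerD => //; apply: le_trans (rnormB _ _) (lerD g1 g3).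
have : 0 <= e * rnorm s ^+ 2 by rewrite mulr_ge0 ?exprn_ge0 // ltW.
lra.
Qed.

(** [cubic] is the diagonal of a trilinear map [T], hence a polynomial of degree at most 3 in [s]
    along any line. *)
Lemma cubic_line_differentiable k (a b : 'rV[C R]_n) z : differentiable (fun s : C R => cubic (a + s *: b) 0 k) z.
Proof.
pose T u v w := frechet f 0 [:: u; v; w] - frechet f 0 [:: u; frechet f 0 [:: v; w]].
have T1 c u u' v w : T (c *: u + u') v w = c *: T u v w + T u' v w.
  rewrite /T (@frechetP [::] [:: v; w] c u u' _ polydisk0).
  rewrite (@frechetP [::] [:: frechet f 0 [:: v; w]] c u u' _ polydisk0).
  by rewrite opprD addrACA scalerBr.
have T2 c u v v' w : T u (c *: v + v') w = c *: T u v w + T u v' w.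
  rewrite /T (@frechetP [:: u] [:: w] c v v' _ polydisk0).
  rewrite (@frechetP [::] [:: w] c v v' _ polydisk0).
  rewrite (@frechetP [:: u] [::] c _ _ _ polydisk0).
  by rewrite opprD addrACA scalerBr.
have T3 c u v w w' : T u v (c *: w + w') = c *: T u v w + T u v w'.
  rewrite /T (@frechetP [:: u; v] [::] c w w' _ polydisk0).
  rewrite (@frechetP [:: v] [::] c w w' _ polydisk0).
  rewrite (@frechetP [:: u] [::] c _ _ _ polydisk0).
  by rewrite opprD addrACA scalerBr.
have cE y : cubic y = T y y y by [].
clearbody T.
rewrite (_ : (fun s => _) = (fun s : C R => T a a a 0 k + s * (T b a a + T a b a + T a a b) 0 k
  + s ^+ 2 * (T b b a + T b a b + T a b b) 0 k + s ^+ 3 * T b b b 0 k)).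
  have dd j c : differentiable (fun s : C R => s ^+ j * c) z.
    by apply: differentiable_mulC; [apply: differentiable_expC; exact: differentiable_idC|exact: differentiable_cstC].
  apply: differentiable_addC; [apply: differentiable_addC; [apply: differentiable_addC; [exact: differentiable_cstC|exact: (dd 1%N)]|exact: dd]|exact: dd].
apply/funext => s; rewrite cE (addrC a) !T1 !T2 !T3 !mxE; ring.
Qed.
End Holomorphic.
End UpperBound.

(** * From support functionals to the bound on the polydisc *)

Section Bound.
Variables (R : realType) (n : nat).
Implicit Types (f : 'rV[C R]_n -> 'rV[C R]_n) (x y v : 'rV[C R]_n).

Lemma coord_functional (c : C R) (k : 'I_n) :
  exists T : {linear 'rV[C R]_n -> (C R)^o}, forall y, T y = c * y 0 k.
Proof.
have lin : linear (fun y : 'rV[C R]_n => c * y 0 k : (C R)^o).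
  by move=> a u v; rewrite !mxE /GRing.scale /=; ring.
pose T : {linear 'rV[C R]_n -> (C R)^o} :=
  HB.pack (fun y : 'rV[C R]_n => c * y 0 k : (C R)^o) (GRing.isLinear.Build _ _ _ _ _ lin).
by exists T.
Qed.

(** A coordinate attaining the norm, rotated to be positive at [x], is a support functional; the
    constant vector 1 shows that its dual norm reaches 1. *)
Lemma support_coord x (k : 'I_n) (T : {linear 'rV[C R]_n -> (C R)^o}) : x != 0 ->
  rnorm (x 0 k) = rnorm x ->
  (forall y, T y = (x 0 k)^* / rc (rnorm x) * y 0 k) -> support_functionals x T.
Proof.
move=> x0 xk HT; have nx : 0 < rnorm x by rewrite rnorm_gt0.
set c := _ / _ in HT.
have c1 : rnorm c = 1.
  by rewrite /c rnormM rnormV rnorm_conj xk rnorm_rc gtr0_norm // divff // gt_eqF.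
have nT y : rnorm (T y) = rnorm (y 0 k).
  by rewrite HT -[LHS]/(rnorm (c * y 0 k)) rnormM c1 mul1r.
split; last first.
  rewrite HT /c mulrAC (mulrC (_^*)) mul_conj xk rcX expr2 mulfK //.
  by rewrite rc_eq0 gt_eqF.
have ub : ubound [set rnorm (T y) | y in [set y : 'rV[C R]_n | rnorm y <= 1]] 1.
  by move=> _ [y /= y1 <-]; rewrite nT; exact: le_trans (rnorm_coord _ _) y1.
have in1 : [set rnorm (T y) | y in [set y : 'rV[C R]_n | rnorm y <= 1]] 1.
  exists (const_mx 1) => /=; first by apply: rnorm_rV_le => // j; rewrite mxE rnorm1.
  by rewrite nT mxE rnorm1.
apply/eqP; rewrite eq_le; apply/andP; split; first by apply: ge_sup => //; exists 1.
by apply: ub_le_sup => //; exists 1.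
Qed.

Lemma jacobian_entry f y i j : 'J f y i j = frechet f y [:: delta_mx 0 i] 0 j.
Proof. by rewrite /jacobian mxE. Qed.

Lemma torus_bound (alpha : R) f x k : alpha <= 1 -> quasi_convex_B alpha f ->
  (forall j, rnorm (x 0 j) = 1) -> rnorm (cubic f x 0 k) <= 2 * (1 - alpha).
Proof.
move=> a1 [[f0 J1] [hf uJ] qc] xT.
have xn : rnorm x = 1.
  apply/eqP; rewrite eq_le -{2}(xT k) rnorm_coord andbT.
  by apply: rnorm_rV_le => // j; rewrite xT.
have x1 : rnorm x <= 1 by rewrite xn.
have inD (s : C R) : rnorm s < 1 -> polydisk (s *: x) by exact: polydiskZ.
pose q (s : C R) := s *: frechet f (s *: x) [:: x; x] + frechet f (s *: x) [:: x].
pose P s := q s *m invmx ('J f (s *: x)).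
have HP (s : C R) : rnorm s < 1 -> frechet f (s *: x) [:: P s] = q s.
  by move=> s1; rewrite -[LHS]/('d f (s *: x) (P s)) jacobian_mul mulmxKV //; apply: uJ; exact: inD.
have dl us (s : C R) j : rnorm s < 1 -> differentiable (fun z : C R => frechet f (z *: x) us 0 j) s.
  move=> s1; have [dk _] := diff_coord j (frechet_diff hf us (inD s s1)).
  by have [] := diff_line dk.
have dP (s : C R) : rnorm s < 1 -> differentiable (fun z => P z 0 k) s.
  move=> s1; apply: (@differentiable_mulmx_inv _ _ q (fun z => 'J f (z *: x)) 1) => //.
  - by move=> z z1; apply: uJ; exact: inD.
  - move=> j; rewrite (_ : (fun z => _) = (fun z => z * frechet f (z *: x) [:: x; x] 0 j
       + frechet f (z *: x) [:: x] 0 j)).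
      by apply: differentiable_addC; [apply: differentiable_mulC; [exact: differentiable_idC|exact: dl]|exact: dl].
    by apply/funext => z; rewrite /q; move: (frechet f _ [:: x; x]) (frechet f _ [:: x]) => u v; rewrite !mxE.
  - move=> i j; rewrite (_ : (fun z => _) = (fun z => frechet f (z *: x) [:: delta_mx 0 i] 0 j)).
      exact: dl.
    by apply/funext => z; exact: jacobian_entry.
have re (s : C R) : s != 0 -> rnorm s < 1 -> alpha <= reC ((x 0 k)^* * P s 0 k).
  move=> s0 s1; have ns : 0 < rnorm s by rewrite rnorm_gt0.
  have y0 : s *: x != 0 by rewrite -rnorm_gt0 rnormZ xn mulr1.
  have ny : rnorm (s *: x) = rnorm s by rewrite rnormZ xn mulr1.
  have [T HT] := coord_functional (((s *: x) 0 k)^* / rc (rnorm (s *: x))) k.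
  have yk : rnorm ((s *: x) 0 k) = rnorm (s *: x) by rewrite mxE rnormM xT ny mulr1.
  have := qc _ (inD s s1) y0 T (support_coord y0 yk HT).
  have -> : frechet f (s *: x) [:: s *: x; s *: x] + frechet f (s *: x) [:: s *: x] = s *: q s.
    have fz1 : frechet f (s *: x) [:: s *: x; s *: x] = s *: (s *: frechet f (s *: x) [:: x; x]).
      exact: (etrans (@frechetZ _ _ _ hf [::] [:: s *: x] s x _ (inD s s1))
        (congr1 (fun u => s *: u) (@frechetZ _ _ _ hf [:: x] [::] s x _ (inD s s1)))).
    have fz2 : frechet f (s *: x) [:: s *: x] = s *: frechet f (s *: x) [:: x].
      exact: (@frechetZ _ _ _ hf [::] [::] s x _ (inD s s1)).
    rewrite fz1 fz2 /q; move: (frechet f _ [:: x; x]) (frechet f _ [:: x]) => u v.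
    by rewrite scalerDr.
  rewrite -scalemxAl -/(P s) HT ny [(s *: P s) 0 k]mxE [(s *: x) 0 k]mxE rmorphM /=.
  (* The phase of [s] cancels between the functional and the vector, leaving a positive factor and
     an expression holomorphic in [s]. *)
  have -> : s^* * (x 0 k)^* / rc (rnorm s) * (s * P s 0 k) = rc (rnorm s) * ((x 0 k)^* * P s 0 k).
    have := mul_conj s; rewrite rcX => E.
    have r0 : rc (rnorm s) != 0 by rewrite rc_eq0 gt_eqF.
    apply: (mulIf r0); rewrite [RHS]mulrAC -expr2 -E; field; exact: r0.
  by rewrite -/(reC _) reC_rcM mulrC ler_pM2l.
have xx : (x 0 k)^* * x 0 k = 1 by rewrite mulrC mul_conj xT expr1n.
have <- : rnorm ((x 0 k)^* * cubic f x 0 k) = rnorm (cubic f x 0 k).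
  by rewrite rnormM rnorm_conj xT mul1r.
apply: (@caratheodory _ (fun s => (x 0 k)^* * P s 0 k) alpha ((x 0 k)^* * frechet f 0 [:: x; x] 0 k)) => //.
  by move=> s s0 s1; split; [apply: differentiable_mulC; [exact: differentiable_cstC|exact: dP]|exact: re].
move=> e e0; have [d d0 Hd] := radial_expansion hf J1 x1 HP e0; exists d => // s _ /Hd h.
have gen (u a b : 'rV[C R]_n) (p r : C R) : (u - (x + p *: a + r *: b)) 0 k =
  u 0 k - (x 0 k + p * a 0 k + r * b 0 k) by rewrite !mxE.
have := le_trans (rnorm_coord _ k) h; rewrite gen; apply: le_trans.
rewrite -{1}xx; move: (P s 0 k) (frechet f 0 [:: x; x] 0 k) (cubic f x 0 k) (x 0 k) (xT k) => u a b w w1.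
rewrite (_ : _ - _ = w^* * (u - (w + s * a + s ^+ 2 * b))); last by ring.
by rewrite rnormM rnorm_conj w1 mul1r.
Qed.

Lemma third_order_cubic f x : holomorphic f ->
  third_order_functional f x = 6^-1 *: cubic f x.
Proof.
move=> hf; rewrite /third_order_functional /cubic.
rewrite (@frechetZ _ _ _ hf [:: x] [::] _ _ _ (polydisk0 R n)).
move: (frechet f 0 [:: x; x; x]) (frechet f 0 ([:: x] ++ _)) => u v.
have -> : 3`!%:R = 6 :> C R by [].
have -> : 2`!%:R = 2 :> C R by [].
by rewrite !scalerA scalerBr; congr (_ - _ *: _); field.
Qed.

Lemma cubic_scale f (c : C R) x : holomorphic f -> cubic f (c *: x) = c ^+ 3 *: cubic f x.
Proof.
move=> hf; have p0 := polydisk0 R n.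
rewrite /cubic (@frechetZ _ _ _ hf [::] [:: c *: x; c *: x] c x _ p0).
rewrite (@frechetZ _ _ _ hf [:: x] [:: c *: x] c x _ p0).
rewrite (@frechetZ _ _ _ hf [:: x; x] [::] c x _ p0).
rewrite (@frechetZ _ _ _ hf [::] [:: frechet f 0 [:: c *: x; c *: x]] c x _ p0).
rewrite (@frechetZ _ _ _ hf [::] [:: c *: x] c x _ p0).
rewrite (@frechetZ _ _ _ hf [:: x] [::] c x _ p0).
rewrite (@frechetZ _ _ _ hf [:: x] [::] c (c *: frechet f 0 ([:: x] ++ [:: x])) _ p0).
rewrite (@frechetZ _ _ _ hf [:: x] [::] c (frechet f 0 ([:: x] ++ [:: x])) _ p0).
move: (frechet f 0 ([:: x; x] ++ [:: x])) (frechet f 0 ([:: x] ++ [:: frechet f 0 ([:: x] ++ [:: x])])) => u v.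
by rewrite !scalerA scalerBr !exprS expr0 mulr1 !mulrA.
Qed.

(** The maximum principle extends the torus bound to the closed unit ball, and homogeneity of degree
    3 carries it to every [x] after normalisation. *)
Lemma upper_bound (alpha : R) f x : alpha <= 1 -> quasi_convex_B alpha f ->
  rnorm (third_order_functional f x) <= (1 - alpha) / 3 * rnorm x ^+ 3.
Proof.
move=> a1 qf; have [_ [hf _] _] := qf.
have a0 : 0 <= 1 - alpha by rewrite subr_ge0.
have cube u : rnorm u <= 1 -> rnorm (cubic f u) <= 2 * (1 - alpha).
  move=> u1; apply: rnorm_rV_le; first by rewrite mulr_ge0.
  move=> k; apply: (@polydisk_max _ _ (fun y => cubic f y 0 k)).
  - by move=> a b z; exact: cubic_line_differentiable.
  - by move=> y yT; exact: torus_bound.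
  - by move=> j; exact: le_trans (rnorm_coord _ _) u1.
have r6 : rnorm (6^-1 : C R) = 6^-1 by rewrite rnormV -(rc_nat _ 6) rnorm_rc ger0_norm.
rewrite third_order_cubic // rnormZ r6.
have [->|x0] := eqVneq x 0.
  rewrite -(scale0r 0) cubic_scale // expr0n scale0r scale0r rnorm0.
  by rewrite !mulr0 mulr_ge0 ?divr_ge0 ?exprn_ge0.
have nx : 0 < rnorm x by rewrite rnorm_gt0.
pose u := rc (rnorm x)^-1 *: x; have u1 : rnorm u = 1.
  by rewrite rnormZ rnorm_rc ger0_norm ?invr_ge0 ?(ltW nx) // mulVf // gt_eqF.
have un : rnorm u <= 1 by rewrite u1.
have -> : cubic f x = rc (rnorm x) ^+ 3 *: cubic f u.
  by rewrite -cubic_scale // /u scalerA -rcM divff ?gt_eqF // rc1 scale1r.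
rewrite rnormZ rnormX rnorm_rc (gtr0_norm nx).
have p3 : 0 <= rnorm x ^+ 3 by rewrite exprn_ge0 // ltW.
have : rnorm x ^+ 3 * rnorm (cubic f u) <= rnorm x ^+ 3 * (2 * (1 - alpha)).
  by rewrite ler_wpM2l // cube.
lra.
Qed.
End Bound.

(** * Sharpness *)

Section Extremal.
Variable R : realType.
Implicit Types (b r t : R) (k N : nat) (w z s : C R).

(* [(-1)^k] times the binomial coefficient of [- b] over [k]. *)
Definition binom_coef b k : R := \prod_(i < k) ((b + i%:R) / i.+1%:R).

Lemma binom_coef0 b : binom_coef b 0 = 1. Proof. by rewrite /binom_coef big_ord0. Qed.
Lemma binom_coefS b k : k.+1%:R * binom_coef b k.+1 = (b + k%:R) * binom_coef b k.
Proof.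
by rewrite /binom_coef big_ord_recr /= mulrCA [X in _ * X]mulrC divfK ?pnatr_eq0 // mulrC.
Qed.
Lemma binom_coef_ge0 b k : 0 < b -> 0 <= binom_coef b k.
Proof.
by move=> b0; apply: prodr_ge0 => i _; rewrite divr_ge0 // addr_ge0 // ltW.
Qed.
Lemma binom_coef_dec b k : 0 < b -> b <= 1 -> binom_coef b k.+1 <= binom_coef b k.
Proof.
move=> b0 b1; have p : (0 : R) < k.+1%:R by rewrite ltr0n.
rewrite -(ler_pM2l p) binom_coefS ler_wpM2r ?binom_coef_ge0 //.
by rewrite -natr1 addrC lerD2l.
Qed.
Lemma binom_coef_le1 b k : 0 < b -> b <= 1 -> binom_coef b k <= 1.
Proof.
move=> b0 b1; elim: k => [|k IH]; first by rewrite binom_coef0.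
exact: le_trans (binom_coef_dec k b0 b1) IH.
Qed.

(* Taylor polynomial in [w] of [(1 - w) ^ (- b)], and [w] times its derivative. *)
Definition trunc_sum b N w : C R := \sum_(k < N.+1) rc (binom_coef b k) * w ^+ k.
Definition trunc_dsum b N w : C R := \sum_(k < N.+1) rc (binom_coef b k) * w ^+ k * k%:R.

(** The function h = (1 - w)^(-b) satisfies (1 - w) w h' = b w h. For the truncation the recurrence
    [binom_coefS] cancels all but the top term. *)
Lemma trunc_ode b N w : (1 - w) * trunc_dsum b N w =
  rc b * w * trunc_sum b N w - rc ((b + N%:R) * binom_coef b N) * w ^+ N.+1.
Proof.
rewrite /trunc_dsum /trunc_sum; elim: N => [|N IH].
  by rewrite !big_ord1 binom_coef0 /= mulr1 rcD !rc_nat rc1; ring.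
rewrite big_ord_recr [in RHS]big_ord_recr /= [LHS]mulrDr IH -binom_coefS !rcM rcD !rc_nat.
rewrite (exprS w N.+1) -!natr1; ring.
Qed.

(** Multiplication by [1 - w] produces differences of the decreasing coefficients, whose absolute
    values telescope to 1 minus the last coefficient; the top term supplies the rest. The truncation
    is thereby kept away from 0. *)
Lemma trunc_sum_near1 b N r w : 0 < b -> b <= 1 -> r <= 1 -> rnorm w <= r ->
  rnorm ((1 - w) * trunc_sum b N w - 1) <= r.
Proof.
move=> b0 b1 r1 wr; have n0 := rnorm_ge0 w; have r0 : 0 <= r by exact: le_trans wr.
have wk k : rnorm (w ^+ k.+1) <= r.
  rewrite rnormX exprS; apply: le_trans (wr); rewrite ler_piMr // exprn_ile1 //.
  exact: le_trans wr r1.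
have H : rnorm ((1 - w) * trunc_sum b N w - 1 + rc (binom_coef b N) * w ^+ N.+1)
    <= r * (1 - binom_coef b N).
  rewrite /trunc_sum; elim: N => [|N IH].
    rewrite big_ord1 binom_coef0 subrr mulr0.
    by rewrite (_ : _ + _ = 0) ?rnorm0 // rc1; ring.
  rewrite big_ord_recr /=; set S := \sum_(i < _) _ in IH *.
  have -> : (1 - w) * (S + rc (binom_coef b N.+1) * w ^+ N.+1) - 1
      + rc (binom_coef b N.+1) * w ^+ N.+2 =
    ((1 - w) * S - 1 + rc (binom_coef b N) * w ^+ N.+1)
    + rc (binom_coef b N.+1 - binom_coef b N) * w ^+ N.+1.
    by rewrite rcB (exprS w N.+1); ring.
  apply: le_trans (rnormD _ _) (le_trans (lerD IH (_ : _ <= (binom_coef b N - binom_coef b N.+1) * r)) _).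
    have d := binom_coef_dec N b0 b1.
    by rewrite rnormM rnorm_rc distrC ger0_norm ?subr_ge0 // ler_wpM2l ?subr_ge0.
  lra.
have -> : (1 - w) * trunc_sum b N w - 1 =
  ((1 - w) * trunc_sum b N w - 1 + rc (binom_coef b N) * w ^+ N.+1) - rc (binom_coef b N) * w ^+ N.+1.
  by ring.
apply: le_trans (rnormB _ _) _; apply: le_trans (lerD H (_ : _ <= binom_coef b N * r)) _.
  by rewrite rnormM rnorm_rc ger0_norm ?binom_coef_ge0 // ler_wpM2l ?binom_coef_ge0.
lra.
Qed.

Lemma trunc_sum_lower b N r w : 0 < b -> b <= 1 -> r <= 1 -> rnorm w <= r ->
  1 - r <= rnorm ((1 - w) * trunc_sum b N w).
Proof.
move=> b0 b1 r1 wr; have h := trunc_sum_near1 N b0 b1 r1 wr.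
set u := _ * _ in h *.
have : rnorm (1 : C R) <= rnorm u + rnorm (u - 1).
  by rewrite {1}(_ : 1 = u - (u - 1)); [exact: rnormB|ring].
rewrite rnorm1; lra.
Qed.

(** The extreme value is taken at w = -r. With u = 1 - w one has w/u = 1/u - 1 and 2 Re u = |u|^2 +
    1 - |w|^2, and |u| is at most 1 + r. *)
Lemma re_geometric r w : r < 1 -> rnorm w <= r -> - (r / (1 + r)) <= reC (w / (1 - w)).
Proof.
move=> r1 wr; have n0 := rnorm_ge0 w; have r0 : 0 <= r by exact: le_trans wr.
set u := 1 - w.
have ul : 1 - r <= rnorm u.
  have : rnorm (1 : C R) <= rnorm u + rnorm w.
    by rewrite {1}(_ : 1 = u + w); [exact: rnormD|rewrite /u; ring].
  by rewrite rnorm1; lra.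
have un : rnorm u <= 1 + r by apply: le_trans (rnormB _ _) _; rewrite rnorm1 lerD2l.
have u0 : 0 < rnorm u by lra.
have u0' : u != 0 by rewrite -rnorm_gt0.
have nu : 0 < rnorm u ^+ 2 by rewrite exprn_gt0.
have -> : w / u = u^* * rc ((rnorm u ^+ 2)^-1) - 1.
  have E : u^* * rc ((rnorm u ^+ 2)^-1) = u^-1.
    apply: (mulfI u0'); rewrite mulrA mul_conj -rcM divff ?gt_eqF // divff //.
  by rewrite E (_ : w = 1 - u); [field|rewrite /u; ring].
rewrite reCB [u^* * _]mulrC reC_rcM reC_conj.
have -> : reC (1 : C R) = 1 by [].
have sq : reC u ^+ 2 + imC u ^+ 2 = rnorm u ^+ 2 by rewrite rnorm_sqr.
have sw : rnorm w ^+ 2 = (1 - reC u) ^+ 2 + imC u ^+ 2.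
  rewrite rnorm_sqr /u; case: (w) => a b'; rewrite /reC /imC /=; ring.
have w2 : rnorm w ^+ 2 <= r ^+ 2 by rewrite ler_pXn2r.
have u2 : rnorm u ^+ 2 <= (1 + r) ^+ 2 by rewrite ler_pXn2r ?nnegrE //; lra.
rewrite lerBrDr [(rnorm u ^+ 2)^-1 * _]mulrC ler_pdivlMr //.
have p1 : 0 < 1 + r by lra.
have -> : - (r / (1 + r)) + 1 = (1 + r)^-1 by field; rewrite gt_eqF.
rewrite [_^-1 * _]mulrC ler_pdivrMr //.
have h1 : (1 - r) * rnorm u ^+ 2 <= (1 - r) * (1 + r) ^+ 2 by rewrite ler_pM2l // subr_gt0.
have h2 : (1 + r) * (rnorm u ^+ 2 + 1 - r ^+ 2) <= (1 + r) * (2 * reC u).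
  by rewrite ler_pM2l //; lra.
move: h1 h2; move: (rnorm u) (reC u) => U a; rewrite !expr2; lra.
Qed.

(** Writing the ratio as a square reduces the decay of m s0^(2m) to the boundedness of m s0^m, which
    follows from 1 + s0 + ... + s0^(m-1) >= m s0^m. A positive [N] ensures that the cubic term of
    the extremal polynomial is present. *)
Lemma nat_mul_expr_small (s0 d : R) : 0 < s0 -> s0 < 1 -> 0 < d ->
  exists2 N, (0 < N)%N & N.+1%:R * (s0 ^+ 2) ^+ N.+1 <= d :> R.
Proof.
move=> p0 p1 d0.
have H m : m%:R * s0 ^+ m * (1 - s0) <= 1 - s0 ^+ m :> R.
  elim: m => [|m IH]; first by rewrite mul0r mul0r expr0 subrr.
  rewrite exprS -natr1; set x := s0 ^+ m in IH *.
  have x0 : 0 <= x by rewrite exprn_ge0 // ltW.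
  have x1 : x <= 1 by rewrite exprn_ile1 // ltW.
  have h1 : s0 * (m%:R * x * (1 - s0)) <= s0 * (1 - x) by rewrite ler_wpM2l // ltW.
  have h2 : 0 <= (1 - s0) * (1 - s0 * x).
    by rewrite mulr_ge0 ?subr_ge0 ?(ltW p1) // mulr_ile1 // ltW.
  have e1 : s0 * (m%:R * x * (1 - s0)) = m%:R * (s0 * x) * (1 - s0) by ring.
  have : (m%:R + 1) * (s0 * x) * (1 - s0) = s0 * (m%:R * x * (1 - s0)) + s0 * x * (1 - s0) by ring.
  by move=> ->; move: h1 h2; set y := s0 * (m%:R * x * (1 - s0)); nra.
have q0 : 0 < 1 - s0 by rewrite subr_gt0.
pose a := ((1 - s0) ^+ 2 * d)^-1.
have a0 : 0 < (1 - s0) ^+ 2 * d by rewrite mulr_gt0 // exprn_gt0.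
exists (Num.trunc a).+1 => //; set N := (Num.trunc a).+1.
have Na : a <= N.+1%:R.
  by apply: ltW; apply: lt_le_trans (truncnS_gt a) _; rewrite ler_nat.
have := H N.+1; set x := s0 ^+ N.+1; set M := N.+1%:R => h.
have x0 : 0 < x by rewrite exprn_gt0.
have M0 : 0 < M by rewrite ltr0n.
have hb : M * x * (1 - s0) <= 1 by apply: le_trans h _; rewrite gerBl ltW.
rewrite -exprM mulnC exprM -/x expr2.
have a1 : 1 <= M * ((1 - s0) ^+ 2 * d) by rewrite -ler_pdivrMr // div1r.
have MX : 0 <= M * x * (1 - s0).
  by apply: mulr_ge0; [apply: mulr_ge0; exact: ltW|exact: ltW].
have h2 : (M * x * (1 - s0)) ^+ 2 <= 1 by exact: exprn_ile1.
have h3 : (M * x * (1 - s0)) ^+ 2 <= M * ((1 - s0) ^+ 2 * d) by exact: le_trans a1.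
have e3 : (M * x * (1 - s0)) ^+ 2 = (M * (1 - s0) ^+ 2) * (M * (x * x)) by ring.
have e4 : M * ((1 - s0) ^+ 2 * d) = (M * (1 - s0) ^+ 2) * d by ring.
by move: h3; rewrite e3 e4 ler_pM2l // mulr_gt0 // exprn_gt0.
Qed.

(** The main term loses at most 2 b r / (1 + r), which leaves b (1 - r) / (1 + r) of the permitted
    loss b. The truncation error may use this, and the second factor 1 - r in the hypothesis pays
    for division by the lower bound of [trunc_sum_lower]. *)
Lemma trunc_re b r N w : 0 < b -> b <= 1 -> 0 <= r -> r < 1 ->
  N.+1%:R * r ^+ N.+1 <= b * (1 - r) ^+ 2 / (2 * (1 + r)) -> rnorm w <= r ->
  trunc_sum b N w != 0 /\ 1 - b <= reC (1 + 2 * (trunc_dsum b N w / trunc_sum b N w)).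
Proof.
move=> b0 b1 r0 r1 HN wr; have r1' := ltW r1; have q0 : 0 < 1 - r by rewrite subr_gt0.
have lo := trunc_sum_lower N b0 b1 r1' wr.
have n0 : 0 < rnorm ((1 - w) * trunc_sum b N w) by exact: lt_le_trans lo.
have : (1 - w) * trunc_sum b N w != 0 by rewrite -rnorm_gt0.
rewrite mulf_eq0 negb_or => /andP[w1 S0]; split=> //.
set t := rc ((b + N%:R) * binom_coef b N) * w ^+ N.+1.
have -> : trunc_dsum b N w / trunc_sum b N w =
    rc b * (w / (1 - w)) - t / ((1 - w) * trunc_sum b N w).
  have := trunc_ode b N w; rewrite -/t => E.
  have -> : trunc_dsum b N w = ((1 - w) * trunc_dsum b N w) / (1 - w) by field.
  by rewrite E; field; rewrite S0.
have tb : rnorm t <= N.+1%:R * r ^+ N.+1.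
  rewrite /t rnormM rnorm_rc rnormX ger0_norm; last first.
    by rewrite mulr_ge0 ?binom_coef_ge0 // addr_ge0 // ltW.
  apply: ler_pM; rewrite ?exprn_ge0 ?rnorm_ge0 //.
  - by rewrite mulr_ge0 ?binom_coef_ge0 // addr_ge0 // ltW.
  - rewrite -natr1 -[leRHS]mulr1; apply: ler_pM; rewrite ?binom_coef_ge0 ?binom_coef_le1 ?addr_ge0 ?(ltW b0) //.
    by rewrite (addrC b) lerD2l.
  - by rewrite lerXn2r // nnegrE // rnorm_ge0.
have tq : rnorm (t / ((1 - w) * trunc_sum b N w)) <= b * (1 - r) / (2 * (1 + r)).
  rewrite rnormM rnormV ler_pdivrMr //; apply: le_trans tb (le_trans HN _).
  have p1 : 0 < b * (1 - r) / (2 * (1 + r)).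
    by rewrite divr_gt0 ?mulr_gt0 //; lra.
  have -> : b * (1 - r) ^+ 2 / (2 * (1 + r)) = b * (1 - r) / (2 * (1 + r)) * (1 - r).
    by rewrite expr2; field; rewrite gt_eqF //; lra.
  by rewrite ler_pM2l.
have rg := re_geometric r1 wr.
have bg : - (b * (r / (1 + r))) <= b * reC (w / (1 - w)).
  by rewrite -mulrN ler_pM2l.
rewrite reCD -(rc_nat _ 2) reC_rcM reCB reC_rcM.
have -> : reC (1 : C R) = 1 by [].
have tl := le_trans (ler_norm _) (le_trans (reC_le (t / ((1 - w) * trunc_sum b N w))) tq).
have e : 2 * (b * (r / (1 + r))) + 2 * (b * (1 - r) / (2 * (1 + r))) = b.
  by field; rewrite gt_eqF //; lra.
lra.
Qed.

(** Termwise primitive, vanishing at 0, of the Taylor polynomial of (1 - r z^2)^(-b) in w = r z^2.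
    It is odd, with cubic coefficient b r / 3 once [N] is positive. *)
Definition extremal_poly b r N : {poly C R} :=
  \sum_(k < N.+1) (rc (binom_coef b k * r ^+ k) / k.*2.+1%:R) *: 'X^(k.*2.+1).

Lemma extremal_poly0 b r N : (extremal_poly b r N).[0] = 0.
Proof.
rewrite /extremal_poly horner_sum big1 // => k _.
by rewrite hornerZ hornerXn expr0n mulr0.
Qed.

Lemma extremal_poly_deriv b r N z :
  ((extremal_poly b r N)^`()).[z] = trunc_sum b N (rc r * z ^+ 2).
Proof.
rewrite /extremal_poly /trunc_sum raddf_sum /= horner_sum; apply: eq_bigr => k _.
rewrite derivZ derivXn hornerZ hornerMn hornerXn /= -(mulr_natr (z ^+ k.*2)) rcM rcX exprMn -exprM mul2n.
have n0 : k.*2.+1%:R != 0 :> C R by rewrite pnatr_eq0.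
by move: (k.*2.+1%:R) n0 => c c0; field.
Qed.

Lemma extremal_poly_deriv2 b r N z :
  z * ((extremal_poly b r N)^`()^`()).[z] = 2 * trunc_dsum b N (rc r * z ^+ 2).
Proof.
rewrite /extremal_poly /trunc_dsum raddf_sum /= raddf_sum /= horner_sum !mulr_sumr; apply: eq_bigr => k _.
rewrite !derivZ derivXn derivMn derivXn hornerZ !hornerMn hornerXn /=.
rewrite -(mulr_natr (_ *+ k.*2)) -(mulr_natr (z ^+ k.*2.-1)) rcM rcX exprMn -exprM mul2n.
(* At [k = 0] the predecessor is truncated to 0, but the factor [k.*2%:R] vanishes. *)
have e : z * z ^+ k.*2.-1 * k.*2%:R = z ^+ k.*2 * k.*2%:R.
  by case: (k : nat) => [|j]; [rewrite !mulr0|rewrite doubleS /= -exprS].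
have n0 : k.*2.+1%:R != 0 :> C R by rewrite pnatr_eq0.
transitivity (rc (binom_coef b k) * rc r ^+ k * (z * z ^+ k.*2.-1 * k.*2%:R)).
  by move: (k.*2.+1%:R) n0 (k.*2%:R) (z ^+ k.*2.-1) => c c0 a' y; field.
by rewrite e -[in k.*2%:R]mul2n natrM; ring.
Qed.

Lemma extremal_poly_coef2 b r N : ((extremal_poly b r N)^`()^`()).[0] = 0.
Proof.
rewrite horner_coef0 !coef_deriv /extremal_poly coef_sum big1 ?mul0rn // => k _.
by rewrite coefZ coefXn /= eqSS; case: (k : nat) => [|j]; rewrite ?doubleS //= mulr0.
Qed.

Lemma extremal_poly_coef3 b r N : (0 < N)%N ->
  ((extremal_poly b r N)^`()^`()^`()).[0] = rc (2 * b * r).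
Proof.
case: N => // N _; rewrite horner_coef0 !coef_deriv /extremal_poly coef_sum.
rewrite !big_ord_recl big1 /=; last first.
  by move=> k _; rewrite coefZ coefXn /= /bump !leq0n !add1n !doubleS /= mulr0.
rewrite !coefZ !coefXn /= mulr0 add0r addr0 mulr1 /bump /= addn0 /binom_coef big_ord1 addr0 divr1 expr1.
rewrite -!mulrnA -(mulr_natr (_ / _)) !rcM rc_nat.
have -> : 1.*2.+1%:R = 3 :> C R by [].
have -> : (3 * (2 * 1))%:R = 6 :> C R by [].
by field.
Qed.
End Extremal.

(** * The diagonal extremal maps *)

Section Sharpness.
Variables (R : realType) (n : nat).
Implicit Types (p : {poly C R}) (a v x y z : 'rV[C R]_n).

(** The weights [a] close the family under differentiation: a direction is absorbed into them, so
    derivatives of all orders have one form. *)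
Definition diag_poly p a z : 'rV[C R]_n := \row_k (a 0 k * p.[z 0 k]).

Lemma diff_horner p (s : C R) : differentiable (horner p) s /\ 'd (horner p) s 1 = p^`().[s].
Proof.
have [dp ep] : is_derive s 1 (horner p) p^`().[s].
  elim/poly_ind: p => [|p c IH].
    rewrite (_ : horner 0 = cst 0); last by apply/funext => z; rewrite horner0.
    by rewrite deriv0 horner0; exact: is_derive_cst.
  rewrite (_ : horner (p * 'X + c%:P) = horner p * id + cst c); last first.
    by apply/funext => z; rewrite hornerMXaddC.
  apply: is_derive_eq.
  by rewrite derivMXaddC hornerD hornerMX /GRing.scale /= mulr1 addr0 mulrC.
have d := (derivable1_diffP _ _).1 dp.
by split=> //; rewrite -ep deriveE.
Qed.

Lemma diff_diag_poly p a z : differentiable (diag_poly p a) z /\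
  forall v, 'd (diag_poly p a) z v = diag_poly p^`() (\row_k (a 0 k * v 0 k)) z.
Proof.
have H k : differentiable (fun z : 'rV[C R]_n => diag_poly p a z 0 k) z /\
    forall v, 'd (fun z : 'rV[C R]_n => diag_poly p a z 0 k) z v = a 0 k * v 0 k * p^`().[z 0 k].
  have [dh eh] := diff_horner p (z 0 k).
  have [] := @has_diff_eps_linear _ _ _ (fun z : 'rV[C R]_n => diag_poly p a z 0 k) z
     (fun v => a 0 k * v 0 k * p^`().[z 0 k]) (rnorm (a 0 k) * rnorm p^`().[z 0 k]).
  - by move=> c u v; rewrite !mxE /GRing.scale /=; ring.
  - move=> h; rewrite !rnormM mulrAC ler_wpM2l ?mulr_ge0 ?rnorm_ge0 //.
    exact: rnorm_coord.
  - move=> e e0; have a1 : 0 < rnorm (a 0 k) + 1 by rewrite ltr_wpDl ?rnorm_ge0.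
    have [d d0 Hd] := diff_has_diff_eps dh (divr_gt0 e0 a1).
    exists d => // h hd; have hk := rnorm_coord h k.
    have := Hd (h 0 k) (le_lt_trans hk hd).
    rewrite (diff_C1 (h 0 k) dh) eh => hh.
    rewrite !mxE.
    have -> : a 0 k * p.[z 0 k + h 0 k] - a 0 k * p.[z 0 k] - a 0 k * h 0 k * p^`().[z 0 k] =
      a 0 k * (p.[z 0 k + h 0 k] - p.[z 0 k] - p^`().[z 0 k] * h 0 k) by ring.
    rewrite rnormM; apply: le_trans (ler_wpM2l (rnorm_ge0 _) hh) _.
    apply: le_trans (_ : _ <= (rnorm (a 0 k) + 1) * (e / (rnorm (a 0 k) + 1) * rnorm h)) _.
      apply: ler_pM; rewrite ?rnorm_ge0 ?lerDl //.
        by rewrite mulr_ge0 ?rnorm_ge0 // divr_ge0 // ltW.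
      by rewrite ler_wpM2l // divr_ge0 // ltW.
    by rewrite mulrA [_ * (e / _)]mulrC divfK // gt_eqF.
  by move=> dF E; split=> // v; rewrite E.
have D : differentiable (diag_poly p a) z by apply: differentiable_rV => k; exact: (H k).1.
split=> // v; apply/rowP => k.
have [_ e] := diff_coord k D.
rewrite [RHS]mxE [(\row__ _) 0 k]mxE.
exact: (etrans (esym (congr1 (fun A : 'rV[C R]_n -> C R => A v) e)) ((H k).2 v)).
Qed.

Definition extremal p : 'rV[C R]_n -> 'rV[C R]_n := diag_poly p (const_mx 1).

Lemma frechet_diag1 p z v : frechet (extremal p) z [:: v] = diag_poly p^`() v z.
Proof.
rewrite -[LHS]/('d (extremal p) z v) (diff_diag_poly p (const_mx 1) z).2.
by congr diag_poly; apply/rowP => k; rewrite !mxE mul1r.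
Qed.

Lemma frechet_diag2 p z u v : frechet (extremal p) z [:: u; v] =
  diag_poly p^`()^`() (\row_k (u 0 k * v 0 k)) z.
Proof.
have E : (fun y => frechet (extremal p) y [:: v]) = diag_poly p^`() v.
  by apply/funext => y; exact: frechet_diag1.
rewrite -[LHS]/('d (fun y => frechet (extremal p) y [:: v]) z u) E (diff_diag_poly p^`() v z).2.
by congr diag_poly; apply/rowP => k; rewrite !mxE mulrC.
Qed.

Lemma frechet_diag3 p z u v w : frechet (extremal p) z [:: u; v; w] =
  diag_poly p^`()^`()^`() (\row_k (u 0 k * (v 0 k * w 0 k))) z.
Proof.
have E : (fun y => frechet (extremal p) y [:: v; w]) = diag_poly p^`()^`() (\row_k (v 0 k * w 0 k)).
  by apply/funext => y; exact: frechet_diag2.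
rewrite -[LHS]/('d (fun y => frechet (extremal p) y [:: v; w]) z u) E.
rewrite (diff_diag_poly p^`()^`() _ z).2.
by congr diag_poly; apply/rowP => k; rewrite !mxE mulrC.
Qed.

Lemma jacobian_extremal p z : 'J (extremal p) z = diag_mx (\row_k p^`().[z 0 k]).
Proof.
apply/matrixP => i j; rewrite jacobian_entry frechet_diag1 !mxE eqxx /=.
by rewrite [j == i]eq_sym; case: eqP => [->|_]; rewrite ?mul1r ?mul0r ?mulr1n ?mulr0n.
Qed.

Lemma row_mul_diag v (d : 'rV[C R]_n) k : (v *m diag_mx d) 0 k = v 0 k * d 0 k.
Proof. by rewrite mul_mx_diag mxE. Qed.

(* Equality in [T x = ||x||], with [||T|| = 1], forces [t_k x_k = |t_k| ||x||]. *)
Lemma support_functional_pos x (T : {linear 'rV[C R]_n -> (C R)^o}) :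
  support_functionals x T -> exists c : 'I_n -> R,
  [/\ forall k, 0 <= c k, \sum_k c k = rnorm x &
      forall (q : 'I_n -> C R) y, (forall k, y 0 k = x 0 k * q k) ->
        T y = \sum_k rc (c k) * q k].
Proof.
move=> [dT Tx]; pose t k : C R := T (delta_mx 0 k).
have TE y : T y = \sum_k t k * y 0 k.
  rewrite {1}(row_sum_delta y) linear_sum; apply: eq_bigr => k _.
  by rewrite linearZ_LR /GRing.scale /= mulrC.
have bnd y : rnorm y <= 1 -> rnorm (T y) <= \sum_k rnorm (t k).
  move=> y1; rewrite TE -[leLHS]/(rnorm (\sum_k t k * y 0 k)); apply: le_trans (rnorm_sum _ _ _) _; apply: ler_sum => k _.
  by rewrite rnormM ler_piMr ?rnorm_ge0 //; apply: le_trans (rnorm_coord _ _) y1.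
have S1 : \sum_k rnorm (t k) <= 1.
  (* The unit phases at which the dual norm is attained; where [t k = 0] the division returns 0,
     which does no harm. *)
  pose y := \row_k ((t k)^* / rc (rnorm (t k))).
  have y1 : rnorm y <= 1.
    apply: rnorm_rV_le => // k; rewrite mxE rnormM rnormV rnorm_conj rnorm_rc ger0_norm ?rnorm_ge0 //.
    by have [->|t0] := eqVneq (rnorm (t k)) 0; [rewrite mul0r|rewrite divff].
  have Ty : T y = rc (\sum_k rnorm (t k)).
    rewrite TE rc_sum; apply: eq_bigr => k _; rewrite mxE mulrA mul_conj.
    have [t0|t0] := eqVneq (rnorm (t k)) 0; first by rewrite t0 expr0n rc0 mul0r.
    by rewrite rcX expr2 mulfK // rc_eq0.
  rewrite -dT /dual_norm; apply: ub_le_sup.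
    by exists (\sum_k rnorm (t k)) => _ [z /= z1 <-]; exact: bnd.
  exists y => //; rewrite Ty -[LHS]/(rnorm (rc _)) rnorm_rc ger0_norm //.
  by apply: sumr_ge0 => k _; exact: rnorm_ge0.
have tx k : reC (t k * x 0 k) <= rnorm (t k) * rnorm x.
  apply: le_trans (le_trans (ler_norm _) (reC_le _)) _.
  by rewrite rnormM ler_wpM2l ?rnorm_ge0 // rnorm_coord.
have Sx : \sum_k reC (t k * x 0 k) = rnorm x.
  by rewrite -reC_sum -TE Tx.
(* The terms are nonnegative and their sum is at most 0 by [S1] and [Sx], so each of them
   vanishes. *)
have Sd : \sum_k (rnorm (t k) * rnorm x - reC (t k * x 0 k)) = 0.
  apply/eqP; rewrite eq_le; apply/andP; split; last first.
    by apply: sumr_ge0 => k _; rewrite subr_ge0.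
  rewrite sumrB Sx -mulr_suml subr_le0 ler_piMl ?rnorm_ge0 //.
have eqk k : reC (t k * x 0 k) = rnorm (t k) * rnorm x.
  apply/eqP; rewrite eq_sym -subr_eq0; apply/eqP.
  by have/psumr_eq0P := Sd; apply=> // j _; rewrite subr_ge0.
have real k : t k * x 0 k = rc (rnorm (t k) * rnorm x).
  have nk : rnorm (t k * x 0 k) <= rnorm (t k) * rnorm x.
    by rewrite rnormM ler_wpM2l ?rnorm_ge0 // rnorm_coord.
  have im0 : imC (t k * x 0 k) = 0.
    apply/eqP; rewrite -sqrf_eq0 eq_le sqr_ge0 andbT.
    have := rnorm_sqr (t k * x 0 k); rewrite eqk => E.
    have : rnorm (t k * x 0 k) ^+ 2 <= (rnorm (t k) * rnorm x) ^+ 2.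
      by rewrite lerXn2r ?nnegrE ?rnorm_ge0 ?mulr_ge0 ?rnorm_ge0.
    rewrite E; lra.
  by rewrite [LHS]C_split im0 eqk rc0 mulr0 addr0.
exists (fun k => rnorm (t k) * rnorm x); split=> [k||q y yq].
- by rewrite mulr_ge0 ?rnorm_ge0.
- by rewrite -[RHS]Sx; apply: eq_bigr => k _; rewrite eqk.
- by rewrite TE; apply: eq_bigr => k _; rewrite yq mulrA real.
Qed.

(** The map acts on each coordinate separately, so a support functional evaluates to a nonnegative
    combination, of total weight [rnorm x], of the one-variable quantities 1 + z p''/p' bounded in
    [trunc_re]. *)
Lemma extremal_quasi_convex (b s0 : R) N : 0 < b -> b <= 1 -> 0 < s0 -> s0 < 1 ->
  N.+1%:R * (s0 ^+ 2) ^+ N.+1 <= b * (1 - s0 ^+ 2) ^+ 2 / (2 * (1 + s0 ^+ 2)) ->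
  quasi_convex_B (1 - b) (extremal (extremal_poly b (s0 ^+ 2) N)).
Proof.
move=> b0 b1 p0 p1 HN; set r := s0 ^+ 2 in HN *; set p := extremal_poly b r N.
have r0 : 0 <= r by rewrite exprn_ge0 // ltW.
have r1 : r < 1 by rewrite exprn_ilt1 // ltW.
have key x k : polydisk x -> p^`().[x 0 k] != 0 /\
    1 - b <= reC (1 + x 0 k * p^`()^`().[x 0 k] / p^`().[x 0 k]).
  move=> px; have wr : rnorm (rc r * x 0 k ^+ 2) <= r.
    rewrite rnormM rnorm_rc ger0_norm // rnormX ler_piMr // exprn_ile1 ?rnorm_ge0 //.
    exact: le_trans (rnorm_coord _ _) (ltW px).
  have [S0 H] := trunc_re b0 b1 r0 r1 HN wr.
  by rewrite extremal_poly_deriv extremal_poly_deriv2 -mulrA.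
split.
- split; first by apply/rowP => k; rewrite !mxE extremal_poly0 mulr0.
  rewrite jacobian_extremal; apply/matrixP => i j; rewrite !mxE extremal_poly_deriv.
  rewrite expr0n mulr0 /trunc_sum big_ord_recl expr0 binom_coef0 big1 ?addr0 ?mulr1 // => k _.
  by rewrite exprS mul0r mulr0.
- split; first by move=> x _; exact: (diff_diag_poly p (const_mx 1) x).1.
  move=> x px; rewrite unitmxE unitfE jacobian_extremal det_diag.
  by apply/prodf_neq0 => k _; rewrite mxE; exact: (key x k px).1.
move=> x px x0 T /support_functional_pos[c [c0 cs cT]].
have uJ : 'J (extremal p) x \in unitmx.
  rewrite unitmxE unitfE jacobian_extremal det_diag.
  by apply/prodf_neq0 => k _; rewrite mxE; exact: (key x k px).1.
pose q k : C R := 1 + x 0 k * p^`()^`().[x 0 k] / p^`().[x 0 k].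
(* Factoring out the Jacobian lets [mulmxK] cancel the inverse without computing it. *)
have -> : frechet (extremal p) x [:: x; x] + frechet (extremal p) x [:: x] =
    (\row_k (x 0 k * q k)) *m 'J (extremal p) x.
  rewrite frechet_diag1 frechet_diag2 jacobian_extremal; apply/rowP => k.
  rewrite row_mul_diag !mxE /q; have [d0 _] := key x k px.
  by field.
rewrite mulmxK // (cT q); last by move=> k; rewrite mxE.
rewrite -/(reC _) reC_sum -cs mulr_sumr; apply: ler_sum => k _.
by rewrite reC_rcM mulrC ler_wpM2l // (key x k px).2.
Qed.

Lemma lower_bound (alpha c : R) : (1 <= n)%N -> 0 <= alpha -> alpha < 1 ->
  (forall f : 'rV[C R]_n -> 'rV[C R]_n, quasi_convex_B alpha f ->
     forall x : 'rV[C R]_n, polydisk x ->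
       rnorm (third_order_functional f x) <= c * rnorm x ^+ 3) ->
  (1 - alpha) / 3 <= c.
Proof.
move=> n1 a0 a1 H; rewrite leNgt; apply/negP => lt.
pose b := 1 - alpha; have b0 : 0 < b by rewrite subr_gt0.
have b1 : b <= 1 by rewrite gerBl.
(* The extremal map with r = [s0 ^+ 2] forces [c] to be at least b r / 3, which fails once r exceeds
   [q]. The maximum with 0 keeps [s0] positive even for negative [c]. *)
pose q := Num.max (3 * c / b) 0.
have q0 : 0 <= q by rewrite le_max lexx orbT.
have q1 : q < 1 by rewrite gt_max ltr01 andbT ltr_pdivrMr // mul1r /b; lra.
have qc : 3 * c <= b * q by rewrite (mulrC b) -ler_pdivrMr // le_max lexx.
clearbody q.
pose s0 := (1 + q) / 2; have p0 : 0 < s0 by rewrite /s0; lra.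
have p1 : s0 < 1 by rewrite /s0; lra.
have sq : q < s0 ^+ 2.
  have : 0 < ((1 - q) / 2) ^+ 2 by rewrite exprn_gt0 // divr_gt0 // subr_gt0.
  have -> : ((1 - q) / 2) ^+ 2 = s0 ^+ 2 - q by rewrite /s0; field.
  by rewrite subr_gt0.
clearbody s0.
have r1 : s0 ^+ 2 < 1 by rewrite exprn_ilt1 // ltW.
have r0 : 0 < s0 ^+ 2 by rewrite exprn_gt0.
have d0 : 0 < b * (1 - s0 ^+ 2) ^+ 2 / (2 * (1 + s0 ^+ 2)).
  by apply: divr_gt0; apply: mulr_gt0 => //; [rewrite exprn_gt0 // subr_gt0|rewrite addr_gt0].
have [N N0 HN] := nat_mul_expr_small p0 p1 d0.
have qf := extremal_quasi_convex b0 b1 p0 p1 HN.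
have aE : 1 - b = alpha by rewrite /b; ring.
rewrite aE in qf.
pose x : 'rV[C R]_n := const_mx (rc (2^-1)).
have nx : rnorm x = 2^-1.
  have h : rnorm (rc (2^-1)) = 2^-1 :> R by rewrite rnorm_rc ger0_norm.
  apply/eqP; rewrite eq_le; apply/andP; split.
    by apply: rnorm_rV_le => // k; rewrite mxE h.
  by have := rnorm_coord x (Ordinal n1); rewrite mxE h.
have px : polydisk x by rewrite /polydisk /= nx; lra.
have := H _ qf x px; rewrite nx.
set p := extremal_poly b (s0 ^+ 2) N.
(* The polynomial is odd, so the second derivative at 0 vanishes and the functional reduces to its
   cubic term. *)
have z2 u : frechet (extremal p) 0 [:: x; u] = 0.
  by rewrite frechet_diag2; apply/rowP => k; rewrite !mxE extremal_poly_coef2 mulr0.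
have E : third_order_functional (extremal p) x 0 (Ordinal n1) = rc (b * s0 ^+ 2 / 3 / 8).
  rewrite /third_order_functional z2 !scaler0 subr0 frechet_diag3 !mxE extremal_poly_coef3 //.
  have -> : 3`!%:R = 6 :> C R by [].
  by rewrite !rcM !rcV !rc_nat; field.
move=> h; have := le_trans (rnorm_coord _ (Ordinal n1)) h.
rewrite E rnorm_rc ger0_norm; last by rewrite !divr_ge0 // mulr_ge0 // ltW.
have : b * q < b * s0 ^+ 2 by rewrite ltr_pM2l.
have -> : (2^-1 : R) ^+ 3 = 8^-1 by field.
lra.
Qed.
End Sharpness.

Theorem theorem2p2 (R : realType) (n : nat) (alpha : R)
    (n_ge1 : (1 <= n)%N) (alpha_ge0 : 0 <= alpha) (alpha_lt1 : alpha < 1) :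
  (forall f : 'rV[C R]_n -> 'rV[C R]_n, quasi_convex_B alpha f ->
     forall x : 'rV[C R]_n, polydisk x ->
       rnorm (third_order_functional f x) <= (1 - alpha) / 3 * rnorm x ^+ 3)
  /\
  (forall c : R,
     (forall f : 'rV[C R]_n -> 'rV[C R]_n, quasi_convex_B alpha f ->
        forall x : 'rV[C R]_n, polydisk x ->
          rnorm (third_order_functional f x) <= c * rnorm x ^+ 3) ->
     (1 - alpha) / 3 <= c).
Proof.
split; last by move=> c; exact: lower_bound.
by move=> f qf x _; apply: upper_bound => //; exact: ltW.
Qed.
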